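(* Let $s\in(0,\tfrac12)$ and let $\Omega\subseteq\mathbb{R}^n$ be an open set. If $E\subseteq\mathbb{R}^n$ is a set with smooth boundary that minimizes the $s$-perimeter in $\Omega$, then $$H^s_E(p)=0\qquad\text{for any } p\in(\partial E)\cap\Omega .$$
   Context: For disjoint sets $S_1,S_2\subseteq\mathbb{R}^n$ let $I(S_1,S_2):=\iint_{S_1\times S_2}\frac{dx\,dy}{|x-y|^{n+2s}}$. Write $E^c=\mathbb{R}^n\setminus E$. The $s$-perimeter of $E$ in $\Omega$ is $$\mathrm{Per}_s(E,\Omega):=I(E\cap\Omega,E^c\cap\Omega)+I(E\cap\Omega,E^c\setminus\Omega)+I(E\setminus\Omega,E^c\cap\Omega).$$ That $E$ minimizes the $s$-perimeter in $\Omega$ means that it is a minimizer with fixed data outside $\Omega$, i.e. $\mathrm{Per}_s(E,\Omega)\le\mathrm{Per}_s(F,\Omega)$ for every $F\subseteq\mathbb{R}^n$ with $F\setminus\Omega=E\setminus\Omega$. For a set $E$ with smooth boundary, the nonlocal ($s$-)mean curvature of $E$ at $p\in\partial E$ is $$H^s_E(p):=\int_{\mathbb{R}^n}\frac{\chi_{E^c}(x)-\chi_E(x)}{|x-p|^{n+2s}}\,dx,$$ intended in the principal value sense, namely as $\lim_{\rho\searrow0}\int_{\mathbb{R}^n\setminus B_\rho(p)}\frac{\chi_{E^c}(x)-\chi_E(x)}{|x-p|^{n+2s}}\,dx$, where $\chi_A$ denotes the characteristic function of a set $A$ and $B_\rho(p)$ the ball of radius $\rho$ centered at $p$.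
   Formalization: The formal theorem additionally assumes that E has finite s-perimeter in Ω; without this, for unbounded Ω all competitors can have infinite s-perimeter, so that every such E is a minimizer and the claim fails. *)

(* Defs.v *)
From HB Require Import structures.
From mathcomp Require Import all_boot all_order all_algebra.
From mathcomp Require Import all_classical all_reals all_analysis.
From mathcomp Require Import measurable_realfun.

Set Implicit Arguments.
Unset Strict Implicit.
Unset Printing Implicit Defensive.

Import Order.TTheory GRing.Theory Num.Theory.
Import numFieldNormedType.Exports.

Local Open Scope classical_set_scope.
Local Open Scope ring_scope.

(* R^n is 'rV[R]_n.  Its library topology comes from the max norm, hence is the
   usual one; the Euclidean length is the function enorm below. *)

Definition measure_rV_display : measure_display.
Proof. exact: default_measure_display. Qed.

Section measurable_rV.
Context (R : realType) (n : nat).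

Let coord (i : 'I_n) (x : 'rV[R]_n) : measurableTypeR R := x ord0 i.

Let rV_set0 : g_sigma_preimage coord set0.
Proof. exact: sigma_algebra0. Qed.

Let rV_setC A : g_sigma_preimage coord A -> g_sigma_preimage coord (~` A).
Proof. exact: sigma_algebraC. Qed.

Let rV_bigcup (F : (set 'rV[R]_n)^nat) :
  (forall i, g_sigma_preimage coord (F i)) ->
  g_sigma_preimage coord (\bigcup_i F i).
Proof. exact: sigma_algebra_bigcup. Qed.

(* The product sigma-algebra of the Borel sets of R, i.e. the Borel
   sigma-algebra of R^n. *)
HB.instance Definition _ := @isMeasurable.Build measure_rV_display
  'rV[R]_n (g_sigma_preimage coord) rV_set0 rV_setC rV_bigcup.

End measurable_rV.

Section lebesgue_measure_rV.
Context (R : realType).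

Definition rV_cons n (z : measurableTypeR R * 'rV[R]_n) : 'rV[R]_n.+1 :=
  \row_i (if unlift ord0 i is Some j then z.2 ord0 j else z.1).

Lemma measurable_coord n (i : 'I_n) :
  measurable_fun [set: 'rV[R]_n]
    (fun x : 'rV[R]_n => x ord0 i : measurableTypeR R).
Proof.
move=> _ Y mY; rewrite setTI; apply: sub_sigma_algebra => /=.
rewrite -bigcup_seq/=; exists i => /=; first by rewrite mem_index_enum.
by exists Y => //; rewrite setTI.
Qed.

Lemma measurable_rV_cons n : measurable_fun [set: _] (@rV_cons n).
Proof.
move=> _ Y mY; rewrite setTI.
suff: @measurable _ 'rV[R]_n.+1 `<=`
    [set Y | measurable (@rV_cons n @^-1` Y)] by apply.
apply: smallest_sub.
  split=> /=.
  - by rewrite preimage_set0.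
  - by move=> A mA; rewrite setTD preimage_setC; exact: measurableC.
  - by move=> F mF; rewrite preimage_bigcup; exact: bigcup_measurable.
move=> A; rewrite -bigcup_seq/= => -[i _ [B mB <-]] /=.
rewrite setTI -comp_preimage -[X in measurable X]setTI.
case: (unliftP ord0 i) => [j ->|->].
  rewrite (_ : _ \o _ = (fun x : 'rV[R]_n => x ord0 j : measurableTypeR R)
     \o snd); last by apply/funext => z /=; rewrite mxE liftK.
  exact: (measurableT_comp (measurable_coord j) measurable_snd).
rewrite (_ : _ \o _ = fst).
  exact: (@measurable_fst _ _ (measurableTypeR R) 'rV[R]_n measurableT B mB).
by apply/funext => z /=; rewrite mxE unlift_none.
Qed.

Section succ.
Context (n : nat) (mu : {sigma_finite_measure set 'rV[R]_n -> \bar R}).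

Definition leb_succ : set 'rV[R]_n.+1 -> \bar R :=
  pushforward (lebesgue_measure \x mu)%E (@rV_cons n).

Let leb_succ0 : leb_succ set0 = 0%E.
Proof. by rewrite /leb_succ /pushforward preimage_set0 measure0. Qed.

Let leb_succ_ge0 A : (0 <= leb_succ A)%E.
Proof. by rewrite /leb_succ /pushforward; exact: measure_ge0. Qed.

Let leb_succ_sigma_additive : semi_sigma_additive leb_succ.
Proof.
move=> F mF tF mUF; rewrite /leb_succ /pushforward preimage_bigcup.
have m B : measurable B -> measurable (@rV_cons n @^-1` B).
  by move=> mB; rewrite -[X in measurable X]setTI; exact: measurable_rV_cons.
apply: measure_semi_sigma_additive.
- by move=> k; exact: m.
- apply/trivIsetP => /= i j _ _ ij; rewrite -preimage_setI.
  by move/trivIsetP : tF => /(_ _ _ _ _ ij) ->//; rewrite preimage_set0.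
- by rewrite -preimage_bigcup; exact: m.
Qed.

HB.instance Definition _ := isMeasure.Build _ _ _ leb_succ
  leb_succ0 leb_succ_ge0 leb_succ_sigma_additive.

Let leb_succ_sigma_finite : sigma_finite setT leb_succ.
Proof.
have /sigma_finiteP[G [GT ndG Goo]] := sigma_finiteT mu.
have /sigma_finiteP[F' [F'T ndF F'oo]] := sigma_finiteT (@lebesgue_measure R).
pose tl (x : 'rV[R]_n.+1) : 'rV[R]_n := \row_j x ord0 (lift ord0 j).
have mtl : measurable_fun setT tl.
  move=> _ Y mY; rewrite setTI.
  suff: @measurable _ 'rV[R]_n `<=` [set Y | measurable (tl @^-1` Y)] by apply.
  apply: smallest_sub.
    split=> /=.
    - by rewrite preimage_set0.
    - by move=> A mA; rewrite setTD preimage_setC; exact: measurableC.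
    - by move=> H mH; rewrite preimage_bigcup; exact: bigcup_measurable.
  move=> A; rewrite -bigcup_seq/= => -[i _ [B mB <-]] /=.
  rewrite setTI -comp_preimage -[X in measurable X]setTI.
  rewrite (_ : _ \o _ = (fun x : 'rV[R]_n.+1 =>
    x ord0 (lift ord0 i) : measurableTypeR R)).
    exact: measurable_coord.
  by apply/funext => x /=; rewrite mxE.
pose hd (x : 'rV[R]_n.+1) : measurableTypeR R := x ord0 ord0.
have mhd : measurable_fun setT hd by exact: measurable_coord.
exists (fun k => (hd @^-1` F' k) `&` (tl @^-1` G k)).
  apply/esym/seteqP; split=> // x _.
  have [i _ Fi] : (\bigcup_i F' i) (hd x) by rewrite -F'T.
  have [j _ Gj] : (\bigcup_j G j) (tl x) by rewrite -GT.
  exists (maxn i j) => //; split.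
    by have /subsetPset := ndF _ _ (leq_maxl i j); exact.
  by have /subsetPset := ndG _ _ (leq_maxr i j); exact.
move=> k; have [mF Fk] := F'oo k; have [mG Gk] := Goo k; split.
  apply: measurableI; rewrite -[X in measurable X]setTI.
    exact: mhd.
  exact: mtl.
rewrite /leb_succ /pushforward.
rewrite (_ : _ @^-1` _ = F' k `*` G k).
  by rewrite product_measure1E// lte_mul_pinfty// ge0_fin_numE.
apply/seteqP; split=> -[a b] /=; rewrite /hd mxE unlift_none /=;
  rewrite (_ : tl _ = b)//; apply/rowP => j; rewrite !mxE liftK//.
Qed.

HB.instance Definition _ := Measure_isSigmaFinite.Build _ _ _ leb_succ
  leb_succ_sigma_finite.

End succ.

(* n-dimensional Lebesgue measure on the Borel sets of R^n, as the n-fold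
   product of the one-dimensional one. *)
Fixpoint leb n : {sigma_finite_measure set 'rV[R]_n -> \bar R} :=
  match n with
  | 0 => [the {sigma_finite_measure set 'rV[R]_0 -> \bar R} of
            \d_(0 : 'rV[R]_0)]
  | m.+1 => [the {sigma_finite_measure set 'rV[R]_m.+1 -> \bar R} of
            leb_succ (leb m)]
  end.

Lemma leb_box n (a b : 'I_n -> R) : (forall i, a i <= b i) ->
  leb n [set x | forall i, a i <= x ord0 i <= b i] =
  (\prod_(i < n) (b i - a i))%:E.
Proof.
elim: n a b => [|n IH] a b ab.
  rewrite big_ord0 (_ : [set x | _] = setT); first by rewrite /= diracT.
  by apply/seteqP; split=> // x _ [].
rewrite big_ord_recl EFinM -IH//.
rewrite -[LHS]/((lebesgue_measure \x leb n)%E (@rV_cons n @^-1` _)).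
pose B := [set x : 'rV[R]_n | forall i : 'I_n,
  a (lift ord0 i) <= x ord0 i <= b (lift ord0 i)].
have -> : @rV_cons n @^-1` [set x | forall i, a i <= x ord0 i <= b i] =
    (`[a ord0, b ord0]%classic : set (measurableTypeR R)) `*` B.
  apply/seteqP; split=> -[x y] /=.
    move=> h; split; first by have := h ord0; rewrite mxE unlift_none in_itv.
    by move=> i; have := h (lift ord0 i); rewrite mxE liftK.
  move=> [hx hy] i; rewrite mxE; case: (unliftP ord0 i) => [j ->|->].
    exact: hy.
  by move: hx; rewrite in_itv.
have mB : measurable B.
  rewrite (_ : B = \bigcap_(i in [set: 'I_n])
    ((fun x : 'rV[R]_n => x ord0 i : measurableTypeR R) @^-1`
      `[a (lift ord0 i), b (lift ord0 i)]%classic)).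
    apply: fin_bigcap_measurable => // i _.
    by rewrite -[X in measurable X]setTI; exact: measurable_coord.
  apply/seteqP; split=> x /= h i => [_|]; first by rewrite /= in_itv/=.
  by have := h i I; rewrite /= in_itv.
rewrite product_measure1E//; congr *%E.
rewrite -[LHS]/(lebesgue_measure `[a ord0, b ord0]%classic).
by rewrite lebesgue_measure_itv/= lte_fin -EFinD; case: ltgtP (ab ord0) =>
  // ->; rewrite subrr.
Qed.

End lebesgue_measure_rV.
Arguments leb {R n}.

Section smooth_boundary.
Context (R : realType) (n : nat).

Definition frontier (E : set 'rV[R]_n) : set 'rV[R]_n := closure E `\` E^°.

Definition iter_partial (l : seq 'I_n) (f : 'rV[R]_n -> R) : 'rV[R]_n -> R :=
  foldr (fun i g x => 'D_(delta_mx ord0 i) g x) f l.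

(* C^infinity on U: partial derivatives of all orders exist and are continuous
   at every point of U (used for open U only). *)
Definition smooth_on (U : set 'rV[R]_n) (f : 'rV[R]_n -> R) : Prop :=
  forall (l : seq 'I_n) x, U x ->
    {for x, continuous (iter_partial l f)} /\
    forall i, derivable (iter_partial l f) x (delta_mx ord0 i).

(* Near each of its boundary points, E is the sublevel set of a smooth function
   with nonvanishing gradient; E lies on one side of its boundary, and no
   condition is imposed on which boundary points belong to E. *)
Definition smooth_boundary (E : set 'rV[R]_n) : Prop :=
  forall p, frontier E p ->
    exists (U : set 'rV[R]_n) (phi : 'rV[R]_n -> R),
      [/\ open U, U p, smooth_on U phi,
          forall x, U x -> exists i, 'D_(delta_mx ord0 i) phi x != 0 &
          forall x, U x -> (phi x < 0 -> E x) /\ (0 < phi x -> ~ E x)].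

End smooth_boundary.

Section fractional_perimeter.
Context (R : realType) (n : nat).
Implicit Types (s : R) (E F S Omega : set 'rV[R]_n).

Definition enorm (x : 'rV[R]_n) : R := Num.sqrt (\sum_i x ord0 i ^+ 2).

(* The sets of the completion of the Borel sigma-algebra. *)
Definition lebesgue_measurable E : Prop := completed_algebra_gen leb E.

(* The kernel is nonnegative and the integral of a nonnegative function is
   defined in the library as a supremum over measurable simple functions, so
   that it is insensitive to Borel null sets and has its usual value when S1
   and S2 are Lebesgue measurable but not Borel. *)
Definition interaction s S1 S2 : \bar R :=
  (\int[leb \x leb]_(z in S1 `*` S2)
     ((enorm (z.1 - z.2) `^ (n%:R + 2 * s))^-1)%:E)%E.

Definition sper s E Omega : \bar R :=
  (interaction s (E `&` Omega) (~` E `&` Omega) +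
   interaction s (E `&` Omega) (~` E `\` Omega) +
   interaction s (E `\` Omega) (~` E `&` Omega))%E.

(* Competitors range over the Lebesgue measurable sets. *)
Definition minimizes_sper s E Omega : Prop :=
  lebesgue_measurable E /\
  forall F, lebesgue_measurable F -> F `\` Omega = E `\` Omega ->
    (sper s E Omega <= sper s F Omega)%E.

Definition truncated_mean_curvature s E (p : 'rV[R]_n) (rho : R) : \bar R :=
  (\int[leb]_(x in ~` [set x | (enorm (x - p) < rho)%R])
     ((\1_(~` E) x - \1_E x) / enorm (x - p) `^ (n%:R + 2 * s))%:E)%E.

(* Meaningful only when the limit exists. *)
Definition mean_curvature s E (p : 'rV[R]_n) : \bar R :=
  lim (truncated_mean_curvature s E p rho @[rho --> 0^'+]).

End fractional_perimeter.

(* Main.v *)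
(* Let K(z) = |z|^-(n+2s) and let phi be a local defining function of E near p.
   For a small set A of E inside Omega, comparison with E \ A gives
   I(A, ~E) <= I(A, E \ A).  Take A = E /\ {psi > -t} near p, where
   psi(y) = phi(y) - |y - p|^2; since phi <= 0 on E, A lies in the ball of radius
   sqrt t.  For x in A, write K(S) for the integral of K(x - .) over S and put
   P_x = ~E \/ {y in A | psi y > psi x} and
   N_x = (E \ A) \/ {y in A | psi y < psi x}.  The contributions of A x A to
   the integrals over A of K(P_x) and K(N_x) are exchanged by swapping x and y,
   so that minimality says that the mean over A of K(P_x) - K(N_x) is at most 0
   (after truncating K, whose integral over A x A is infinite).  Outside the ball
   of radius rho around p, K(P_x) - K(N_x) is close to the truncated curvature
   at p.  Inside, the reflection y -> 2x - y exchanges {psi < psi x} and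
   {psi > psi x} up to a set {|a.(y - x)| <= C|y - x|^2}, on which the integral
   of K is at most M rho^(1-2s) by a dyadic decomposition; this is where s < 1/2
   is used.  So the truncated curvature is at most M rho^(1-2s), and the same
   argument applied to the complement of E bounds it from below. *)
From HB Require Import structures.
Require Import Defs.
From mathcomp Require Import all_boot all_order all_algebra.
From mathcomp Require Import all_classical all_reals all_analysis.
From mathcomp Require Import measurable_realfun.
From mathcomp Require Import ring lra.
Set Implicit Arguments.
Unset Strict Implicit.
Unset Printing Implicit Defensive.
Import Order.TTheory GRing.Theory Num.Theory.
Import numFieldNormedType.Exports.
Local Open Scope classical_set_scope.
Local Open Scope ring_scope.

(** * Euclidean norm and Lebesgue measure on 'rV[R]_n *)

(** Neither ~E nor E \ A is balanced near a point x of A: both miss the part of A around x. Adding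
    to one the part of A above the level psi x and to the other the part below it puts the two sets
    on opposite sides of a single level set through x, which is the situation that a reflection at x
    can handle; no flow or change of variables is involved. The added terms can be cancelled only if
    they are finite, hence the truncation. The resulting gain e |A| does not depend on the
    truncation radius, so it survives in the limit and contradicts the finiteness of I(A, ~E). This
    finiteness, and that of the interactions not touching A, which must also be cancelled, comes
    from the finite perimeter of E. Finally, E is only Lebesgue measurable, so A is cut out of a
    Borel set B inside E such that E \ B lies in a Borel null set N. *)

Section enorm.
Context (R : realType) (n : nat).
Implicit Types x y z : 'rV[R]_n.

(** Expanding the nonnegative sum of [(B * a i - C * b i) ^+ 2] gives B (A B - C^2) >= 0, which
    settles the case B > 0; if B = 0, every [b i] vanishes. *)
Lemma cauchy_schwarz (a b : 'I_n -> R) :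
  (\sum_i a i * b i) ^+ 2 <= (\sum_i a i ^+ 2) * (\sum_i b i ^+ 2).
Proof.
set A := \sum_i a i ^+ 2; set B := \sum_i b i ^+ 2; set C := \sum_i a i * b i.
have B0 : 0 <= B by apply: sumr_ge0 => i _; exact: sqr_ge0.
have h : 0 <= B * (A * B - C ^+ 2).
  have : 0 <= \sum_i (B * a i - C * b i) ^+ 2.
    by apply: sumr_ge0 => i _; exact: sqr_ge0.
  have E i : (B * a i - C * b i) ^+ 2 =
    B ^+ 2 * a i ^+ 2 - (2 * B * C) * (a i * b i) + C ^+ 2 * b i ^+ 2 by ring.
  under eq_bigr do rewrite E.
  rewrite big_split/= sumrB -!mulr_sumr -/A -/B -/C.
  by congr (0 <= _); ring.
have [B1|B1] := eqVneq B 0; last first.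
  by move: h; rewrite pmulr_rge0 ?subr_ge0// lt_def B1.
have b0 i : b i = 0.
  move/eqP: B1; rewrite psumr_eq0 => [|j _]; last exact: sqr_ge0.
  by move=> /allP/(_ i (mem_index_enum _))/=; rewrite sqrf_eq0 => /eqP.
rewrite /C big1 ?expr0n/= ?mulr_ge0// ?sumr_ge0// => i _; first exact: sqr_ge0.
by rewrite b0 mulr0.
Qed.

Lemma enorm_ge0 x : 0 <= enorm x. Proof. exact: sqrtr_ge0. Qed.

Lemma enorm_sqr x : enorm x ^+ 2 = \sum_i x ord0 i ^+ 2.
Proof. by rewrite sqr_sqrtr// sumr_ge0// => i _; exact: sqr_ge0. Qed.

Lemma enormN x : enorm (- x) = enorm x.
Proof. by congr Num.sqrt; apply: eq_bigr => i _; rewrite mxE sqrrN. Qed.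

Lemma enormB x y : enorm (x - y) = enorm (y - x).
Proof. by rewrite -enormN opprB. Qed.

Lemma ler_enormD x y : enorm (x + y) <= enorm x + enorm y.
Proof.
rewrite -(@ler_pXn2r _ 2)// ?nnegrE ?addr_ge0 ?enorm_ge0//.
rewrite sqrrD !enorm_sqr.
have E i : (x + y) ord0 i ^+ 2 =
    x ord0 i ^+ 2 + y ord0 i ^+ 2 + 2 * (x ord0 i * y ord0 i).
  by rewrite mxE; ring.
under eq_bigr do rewrite E.
rewrite big_split/= -mulr_sumr big_split/= addrAC lerD2r lerD2l.
rewrite mulr_natl lerMn2r/=.
apply: le_trans (ler_norm _) _.
rewrite -(@ler_pXn2r _ 2)// ?nnegrE ?mulr_ge0 ?enorm_ge0//.
by rewrite exprMn !enorm_sqr real_normK ?num_real// cauchy_schwarz.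
Qed.

Lemma ler_enorm_dist x y z : enorm (x - z) <= enorm (x - y) + enorm (y - z).
Proof. by rewrite (_ : x - z = (x - y) + (y - z)) ?ler_enormD// addrA subrK. Qed.

Lemma ler_coord_enorm x i : `|x ord0 i| <= enorm x.
Proof.
rewrite -(@ler_pXn2r _ 2)// ?nnegrE ?enorm_ge0// enorm_sqr real_normK ?num_real//.
rewrite (bigD1 i)//= lerDl sumr_ge0// => j _; exact: sqr_ge0.
Qed.

Lemma ler_coord_norm x i : `|x ord0 i| <= `|x|.
Proof. rewrite [`|x|]mx_normrE.
by have /bigmax_leP[_ /(_ (ord0, i) isT)] :=
  lexx (\big[Num.max/0]_(i : 'I_1 * 'I_n) `|x i.1 i.2|). Qed.

Lemma norm_le_coord x (c : R) : 0 <= c ->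
  (`|x| <= c) = [forall i, `|x ord0 i| <= c].
Proof.
move=> c0; apply/idP/forallP => [h i|h].
  exact: le_trans (ler_coord_norm x i) h.
rewrite [`|x|]mx_normrE; apply/bigmax_leP; split => // -[i j] _ /=.
by rewrite ord1.
Qed.

Lemma norm_lt_coord x (c : R) : 0 < c ->
  (`|x| < c) = [forall i, `|x ord0 i| < c].
Proof.
move=> c0; apply/idP/forallP => [h i|h].
  exact: le_lt_trans (ler_coord_norm x i) h.
rewrite [`|x|]mx_normrE; apply/bigmax_ltP; split => // -[i j] _ /=.
by rewrite ord1.
Qed.

Lemma norm_le_enorm x : `|x| <= enorm x.
Proof.
by rewrite norm_le_coord ?enorm_ge0//; apply/forallP => i; exact: ler_coord_enorm.
Qed.

Lemma enorm_le_norm x : enorm x <= n%:R * `|x|.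
Proof.
rewrite -(@ler_pXn2r _ 2)// ?nnegrE ?mulr_ge0 ?enorm_ge0// enorm_sqr exprMn.
apply: (@le_trans _ _ (\sum_(i < n) `|x| ^+ 2)).
  apply: ler_sum => i _; rewrite -[x ord0 i ^+ 2]real_normK ?num_real//.
  by rewrite ler_pXn2r ?nnegrE//; exact: ler_coord_norm.
rewrite sumr_const card_ord -[leLHS]mulr_natl ler_wpM2r ?sqr_ge0//.
by rewrite -natrX ler_nat; case: (n) => // m; rewrite leq_pmulr.
Qed.

Lemma enorm_eq0 x : (enorm x == 0) = (x == 0).
Proof.
apply/eqP/eqP => [h|->].
  by apply/eqP; rewrite -normr_le0 -h norm_le_enorm.
apply/eqP; rewrite eq_le enorm_ge0 andbT (le_trans (enorm_le_norm _))//.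
by rewrite normr0 mulr0.
Qed.

End enorm.

Section measurability.
Context (R : realType) (n : nat).

Lemma measurable_cube (c : 'rV[R]_n) (r : R) :
  measurable [set y : 'rV[R]_n | forall i, `|y ord0 i - c ord0 i| < r].
Proof.
rewrite (_ : [set y | _] = \bigcap_(i in [set: 'I_n])
    ((fun x : 'rV[R]_n => x ord0 i : measurableTypeR R) @^-1`
      `]c ord0 i - r, c ord0 i + r[%classic)).
  apply: fin_bigcap_measurable => // i _.
  by rewrite -[X in measurable X]setTI; exact: measurable_coord.
apply/seteqP; split=> x /= h i => [_|].
  by rewrite /= in_itv/= -ltr_distl.
by have := h i I; rewrite /= in_itv/= -ltr_distl.
Qed.

(** The sigma-algebra is generated by the coordinates, so an open set has to be exhausted by
    countably many cubes: those contained in it with rational centre and half-side 1/(k+1). *)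
Lemma open_measurable_rV (O : set 'rV[R]_n) : open O -> measurable O.
Proof.
move=> oO.
pose C (qk : 'rV[rat]_n * nat) : set 'rV[R]_n :=
  [set y | forall i, `|y ord0 i - (map_mx ratr qk.1) ord0 i| < qk.2.+1%:R^-1].
rewrite (_ : O = \bigcup_qk (if `[< C qk `<=` O >] then C qk else set0)).
  apply: countable_bigcupT_measurable; first exact: countableP.
  by move=> qk; case: ifP => // _; exact: measurable_cube.
apply/seteqP; split => [x Ox|x [qk _]]; last by case: asboolP => // + Cx; exact.
have /nbhs_ballP[e/= e0 xe] : nbhs x O by exact: open_nbhs_nbhs.
have [k ke] : exists k : nat, k.+1%:R^-1 < e / 2.
  exists (Num.truncn (e / 2)^-1); rewrite invf_plt ?posrE ?divr_gt0//.
  by rewrite truncnS_gt.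
have k0 : 0 < k.+1%:R^-1 :> R by rewrite invr_gt0.
have hq i : exists q : rat,
    ratr q \in `]x ord0 i - k.+1%:R^-1, x ord0 i + k.+1%:R^-1[%R.
  by apply: rat_in_itvoo; rewrite ltrD2l gtrN.
have /fin_all_exists[q Hq] := hq.
exists (\row_i q i, k) => //.
have Cx : C (\row_i q i, k) x.
  move=> i /=; rewrite !mxE distrC ltr_distl.
  by have := Hq i; rewrite in_itv/=.
case: asboolP => // -[] y Cy; apply: xe.
rewrite -ball_normE/= (norm_lt_coord _ e0); apply/forallP => i.
rewrite !mxE; have := Cy i; have := Cx i; rewrite /= !mxE => h1 h2.
rewrite (le_lt_trans (ler_distD (ratr (q i)) _ _))//.
by rewrite (splitr e) ltrD ?(lt_trans h1)// distrC (lt_trans h2).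
Qed.

Lemma measurable_fun_rV d (T : measurableType d) (f : T -> 'rV[R]_n) :
  (forall i, measurable_fun setT (fun x => f x ord0 i : measurableTypeR R)) ->
  measurable_fun setT f.
Proof.
move=> mf _ Y mY; rewrite setTI.
suff: @measurable _ 'rV[R]_n `<=` [set Y | measurable (f @^-1` Y)] by apply.
apply: smallest_sub.
  split=> /=.
  - by rewrite preimage_set0.
  - by move=> A mA; rewrite setTD preimage_setC; exact: measurableC.
  - by move=> F mF; rewrite preimage_bigcup; exact: bigcup_measurable.
move=> A; rewrite -bigcup_seq/= => -[i _ [B mB <-]] /=.
by rewrite setTI -[X in measurable X]setTI; exact: mf.
Qed.

Lemma measurable_enorm : measurable_fun setT (@enorm R n).
Proof.
apply: measurableT_comp.
  by apply: continuous_measurable_fun; exact: sqrt_continuous.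
apply: measurable_sum => i; apply: measurable_funX; exact: measurable_coord.
Qed.

Lemma measurable_subl (c : 'rV[R]_n) : measurable_fun setT (fun y : 'rV[R]_n => c - y).
Proof.
apply: measurable_fun_rV => i; under eq_fun do rewrite !mxE.
by apply: measurable_funB => //; exact: measurable_coord.
Qed.

Lemma measurable_subr (c : 'rV[R]_n) : measurable_fun setT (fun y : 'rV[R]_n => y - c).
Proof.
apply: measurable_fun_rV => i; under eq_fun do rewrite !mxE.
by apply: measurable_funB => //; exact: measurable_coord.
Qed.

Lemma measurable_enorm_preimage (p : 'rV[R]_n) (Y : set R) : measurable Y ->
  measurable ((fun y : 'rV[R]_n => enorm (y - p)) @^-1` Y).
Proof.
move=> mY; rewrite -[X in measurable X]setTI.
exact: (measurableT_comp measurable_enorm (measurable_subr p)).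
Qed.

Lemma measurable_enorm_le (p : 'rV[R]_n) (r : R) :
  measurable [set y : 'rV[R]_n | enorm (y - p) <= r].
Proof.
rewrite (_ : [set y | _] = (fun y => enorm (y - p)) @^-1` `]-oo, r]%classic).
  by apply: measurable_enorm_preimage; exact: measurable_itv.
by apply/seteqP; split => y /=; rewrite in_itv.
Qed.

Lemma measurable_far (p : 'rV[R]_n) (r : R) :
  measurable (~` [set y | enorm (y - p) < r]).
Proof.
apply: measurableC.
rewrite (_ : [set y | _] = (fun y => enorm (y - p)) @^-1` `]-oo, r[%classic).
  by apply: measurable_enorm_preimage; exact: measurable_itv.
by apply/seteqP; split => y /=; rewrite in_itv.
Qed.

Lemma measurable_shell (p : 'rV[R]_n) (r1 r2 : R) :
  measurable [set y : 'rV[R]_n | r1 <= enorm (y - p) < r2].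
Proof.
rewrite (_ : [set y | _] = (fun y => enorm (y - p)) @^-1` `[r1, r2[%classic).
  by apply: measurable_enorm_preimage; exact: measurable_itv.
by apply/seteqP; split => y /=; rewrite in_itv.
Qed.

Lemma measurable_sub_pair :
  measurable_fun setT (fun z : 'rV[R]_n * 'rV[R]_n => z.1 - z.2).
Proof.
apply: measurable_fun_rV => i; under eq_fun do rewrite !mxE.
apply: measurable_funB.
  exact: (measurableT_comp (measurable_coord i) measurable_fst).
exact: (measurableT_comp (measurable_coord i) measurable_snd).
Qed.

End measurability.

(** * Invariance of Lebesgue measure under point reflections *)

Section reflection.
Context (R : realType).

(** By uniqueness of Lebesgue measure it suffices to test half-open intervals, and the preimage of
    one is an interval of the same length, closed at the other end. *)
Lemma lebesgue_measure_reflect (c : R) (A : set (measurableTypeR R)) :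
  measurable A -> lebesgue_measure ((fun x => c - x) @^-1` A) = lebesgue_measure A.
Proof.
move=> mA.
have mf : measurable_fun setT (fun x : measurableTypeR R => c - x : measurableTypeR R).
  exact: measurable_funB.
pose f : {mfun measurableTypeR R >-> measurableTypeR R} :=
  HB.pack (fun x : measurableTypeR R => c - x : measurableTypeR R)
    (isMeasurableFun.Build _ _ _ _ _ mf).
apply/esym; apply: (lebesgue_measure_unique (mu := pushforward lebesgue_measure f)) => //.
move=> _ [[a b] _ <-].
rewrite -[RHS]/(lebesgue_measure ((fun x => c - x) @^-1` `]a, b]%classic)).
rewrite (_ : _ @^-1` _ = `[c - b, c - a[%classic).
  rewrite !lebesgue_measure_itv/= !lte_fin.
  rewrite ltrD2l ltrN2; case: ifP => // _.
  by rewrite -!EFinD; congr EFin; ring.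
by apply/seteqP; split => x /=; rewrite !in_itv/=; lra.
Qed.

(** Induction on the dimension: the section at x of the reflected set is the reflection of the
    section at [c0 - x], and the remaining integral over x is pushed forward by the one-dimensional
    reflection. *)
Lemma leb_reflect n (c : 'rV[R]_n) (A : set 'rV[R]_n) :
  measurable A -> leb ((fun y => c - y) @^-1` A) = leb A.
Proof.
elim: n c A => [|n IH] c A mA.
  rewrite (_ : _ @^-1` _ = A)//.
  by apply/seteqP; split => x /=; rewrite (_ : c - x = x)//; apply/rowP; case.
pose c0 := c ord0 ord0; pose c' : 'rV[R]_n := \row_j c ord0 (lift ord0 j).
have mA' : measurable (@rV_cons R n @^-1` A).
  by rewrite -[X in measurable X]setTI; exact: measurable_rV_cons.
have E (x : R) : leb (xsection (@rV_cons R n @^-1` ((fun y => c - y) @^-1` A)) x) =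
                 leb (xsection (@rV_cons R n @^-1` A) (c0 - x)).
  rewrite -[RHS](IH c'); last exact: measurable_xsection.
  congr (leb _); apply/seteqP; split => y; rewrite /xsection/= !inE/=;
    rewrite (_ : c - rV_cons (x, y) = rV_cons (c0 - x, c' - y))//;
    by apply/rowP => i; rewrite !mxE/=; case: (unliftP ord0 i) => [j ->|->];
      rewrite ?mxE ?liftK ?unlift_none.
rewrite -[LHS]/((lebesgue_measure \x leb)%E (@rV_cons R n @^-1` _)).
rewrite -[RHS]/((lebesgue_measure \x leb)%E (@rV_cons R n @^-1` _)).
rewrite /product_measure1/=.
under eq_integral do rewrite E.
pose rf := fun x : measurableTypeR R => (c0 - x : measurableTypeR R).
have mf : measurable_fun setT rf by exact: measurable_funB.
have mG := measurable_fun_xsection (leb (n := n)) mA'.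
transitivity (\int[pushforward (@lebesgue_measure R) rf]_x
   leb (xsection (@rV_cons R n @^-1` A) x))%E.
  rewrite (ge0_integral_pushforward mf)//=; by move=> x _; exact: measure_ge0.
apply: eq_measure_integral => B mB _.
exact: lebesgue_measure_reflect.
Qed.

End reflection.

Section product_measure_le.
Local Open Scope ereal_scope.
Context d1 d2 (T1 : measurableType d1) (T2 : measurableType d2) (R : realType).
Variables (m1 : {sigma_finite_measure set T1 -> \bar R})
  (m2 : {sigma_finite_measure set T2 -> \bar R}).

Lemma le_integral_supp d (T : measurableType d)
    (m : {measure set T -> \bar R}) (f : T -> \bar R) (I : set T) (M : \bar R) :
  measurable_fun setT f -> (forall x, 0 <= f x) -> measurable I -> 0 <= M ->
  (forall x, I x -> f x <= M) -> (forall x, ~ I x -> f x = 0) ->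
  \int[m]_x f x <= M * m I.
Proof.
move=> mf f0 mI M0 fM fI; rewrite -integral_cst//.
rewrite [leRHS]integral_mkcond; apply: ge0_le_integral => //.
  apply/(measurable_restrictT (cst M) mI).1; exact: measurable_cst.
move=> x _; rewrite patchE; case: ifPn => [|/negP]; rewrite inE; first exact: fM.
by move=> /fI ->.
Qed.

(** Both orders of integration are needed for slabs: the coordinate in which a slab is thin may
    belong to the second factor or be the first factor itself. *)
Lemma product_measure_le_xsection (S : set (T1 * T2)) (I : set T1) (M : \bar R) :
  measurable S -> measurable I -> 0 <= M ->
  (forall x, I x -> m2 (xsection S x) <= M) ->
  (forall x, ~ I x -> xsection S x = set0) ->
  (m1 \x m2) S <= M * m1 I.
Proof.
move=> mS mI M0 SM S0; apply: le_integral_supp => //.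
- exact: measurable_fun_xsection.
- by move=> x /S0 /= ->; rewrite measure0.
Qed.

Lemma product_measure_le_ysection (S : set (T1 * T2)) (I : set T2) (M : \bar R) :
  measurable S -> measurable I -> 0 <= M ->
  (forall y, I y -> m1 (ysection S y) <= M) ->
  (forall y, ~ I y -> ysection S y = set0) ->
  (m1 \x m2) S <= M * m2 I.
Proof.
move=> mS mI M0 SM S0.
rewrite (@product_measure_unique _ _ _ _ _ m1 m2 (m1 \x^ m2))//; last first.
  by move=> A B mA mB; exact: product_measure2E.
apply: le_integral_supp => //.
- exact: measurable_fun_ysection.
- by move=> x /S0 /= ->; rewrite measure0.
Qed.

End product_measure_le.

(** * Volume of the part of a cube between two parallel hyperplanes *)

Section slab.
Context (R : realType).

Lemma measurable_closed_cube n (c : 'I_n -> R) r :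
  measurable [set y : 'rV[R]_n | forall j, `|y ord0 j - c j| <= r].
Proof.
rewrite (_ : [set y | _] = \bigcap_(i in [set: 'I_n])
    ((fun x : 'rV[R]_n => x ord0 i : measurableTypeR R) @^-1`
      `[c i - r, c i + r]%classic)).
  apply: fin_bigcap_measurable => // i _.
  by rewrite -[X in measurable X]setTI; exact: measurable_coord.
apply/seteqP; split=> x /= hx i => [_|].
  by rewrite /= in_itv/= -ler_distl.
by have := hx i I; rewrite /= in_itv/= -ler_distl.
Qed.

(** The offset [b] serves the induction on the dimension: fixing one coordinate of a slab leaves a
    slab with another offset. *)
Definition slab n (a c : 'I_n -> R) (b r h : R) : set 'rV[R]_n :=
  [set y | (forall j, `|y ord0 j - c j| <= r) /\
           `|\sum_j a j * (y ord0 j - c j) + b| <= h].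

Lemma measurable_slab n (a c : 'I_n -> R) b r h : measurable (slab a c b r h).
Proof.
have mA := measurable_closed_cube c r.
have mf : measurable_fun setT
    (fun y : 'rV[R]_n => `|\sum_j a j * (y ord0 j - c j) + b|).
  apply: measurableT_comp => //; apply: measurable_funD => //.
  apply: measurable_sum => i; apply: measurable_funM => //.
  by apply: measurable_funB => //; exact: measurable_coord.
have mB : measurable [set y : 'rV[R]_n |
    `|\sum_j a j * (y ord0 j - c j) + b| <= h].
  rewrite (_ : [set y | _] = (fun y : 'rV[R]_n =>
      `|\sum_j a j * (y ord0 j - c j) + b|) @^-1` `]-oo, h]%classic).
    by rewrite -[X in measurable X]setTI; apply: mf.
  by apply/seteqP; split => x /=; rewrite in_itv.
exact: (measurableI _ _ mA mB).
Qed.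

Lemma leb_cube n (c : 'I_n -> R) r : 0 <= r ->
  leb [set y : 'rV[R]_n | forall j, `|y ord0 j - c j| <= r] = ((2 * r) ^+ n)%:E.
Proof.
move=> r0; rewrite (_ : [set y | _] =
  [set y : 'rV[R]_n | forall j, c j - r <= y ord0 j <= c j + r]).
  rewrite leb_box => [|i]; last by lra.
  have E i : c i + r - (c i - r) = 2 * r by ring.
  by congr EFin; under eq_bigr do rewrite E; rewrite prodr_const card_ord.
by apply/seteqP; split => x /= h j; have := h j; rewrite ler_distl.
Qed.

Lemma lebesgue_measure_cball (c r : R) : 0 <= r ->
  lebesgue_measure `[c - r, c + r]%classic = (2 * r)%:E.
Proof.
move=> r0; rewrite lebesgue_measure_itv/= lte_fin -EFinD.
case: ifPn => [_|]; first by congr EFin; ring.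
by rewrite -leNgt => ?; congr EFin; lra.
Qed.

(** If [i] is not the first coordinate, the sections at fixed first coordinate are slabs in one
    dimension less. If it is the first, then for fixed other coordinates it ranges in an interval of
    length [2 * h / |a i|], and the others range in a cube. *)
Lemma leb_slab_le n (a c : 'I_n -> R) b r h i :
  0 <= r -> 0 <= h -> a i != 0 ->
  (leb (slab a c b r h) <= ((2 * r) ^+ n.-1 * (2 * h / `|a i|))%:E)%E.
Proof.
move=> r0 h0; elim: n a c b i => [|n IH] a c b i ai; first by case: i ai.
have a0 : 0 < `|a i| by rewrite normr_gt0.
pose S := @rV_cons R n @^-1` slab a c b r h.
have mS : measurable S.
  rewrite -[X in measurable X]setTI; apply: measurable_rV_cons => //.
  exact: measurable_slab.
rewrite -[X in (X <= _)%E]/((lebesgue_measure \x leb)%E S).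
pose a' (j : 'I_n) := a (lift ord0 j); pose c' (j : 'I_n) := c (lift ord0 j).
have SE x y : S (x, y) <-> [/\ `|x - c ord0| <= r,
    (forall j, `|y ord0 j - c' j| <= r) &
    `|a ord0 * (x - c ord0) + (\sum_j a' j * (y ord0 j - c' j) + b)| <= h].
  rewrite /S /slab/= big_ord_recl mxE unlift_none/= -addrA.
  under eq_bigr do rewrite mxE liftK/=.
  split => [[H1 H2]|[H0 H1 H2]].
    split => //; first by have := H1 ord0; rewrite mxE unlift_none.
    by move=> j; have := H1 (lift ord0 j); rewrite mxE liftK.
  split => // j; rewrite mxE; case: (unliftP ord0 j) => [k ->|->] //=.
case: (unliftP ord0 i) ai a0 => [k ->|->] ai a0.
  have {}IH := IH a' c' _ k ai.
  have n0 : (0 < n)%N by exact: leq_ltn_trans (leq0n k) (ltn_ord k).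
  pose I0 : set (measurableTypeR R) := `[c ord0 - r, c ord0 + r]%classic.
  apply: (le_trans (@product_measure_le_xsection _ _ _ _ _ _ _ S I0
    ((2 * r) ^+ n.-1 * (2 * h / `|a (lift ord0 k)|))%:E mS _ _ _ _)).
  - exact: measurable_itv.
  - by rewrite lee_fin !(mulr_ge0, exprn_ge0, invr_ge0)//.
  - move=> x _; apply: le_trans (IH (a ord0 * (x - c ord0) + b)).
    apply: le_measure; rewrite ?inE.
    + by apply: measurable_xsection.
    + exact: measurable_slab.
    + move=> y; rewrite /xsection/= inE => /SE[_ H1 H2]; split => //.
      by apply: le_trans H2; rewrite addrCA.
  - move=> x xI; apply/seteqP; split => // y; rewrite /xsection/= inE => /SE[H _ _].
    by apply: xI; rewrite /I0/= in_itv/= -ler_distl.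
  - rewrite [X in (_ * X <= _)%E](_ : _ = (2 * r)%:E).
      have e : (2 * r) ^+ n = (2 * r) * (2 * r) ^+ n.-1.
        by rewrite -exprS prednK.
      rewrite -EFinM lee_fin [n.+1.-1]/= e.
      set A := (2 * r) ^+ n.-1; set B := 2 * h / _.
      by rewrite (_ : A * B * (2 * r) = 2 * r * A * B)//; ring.
    exact: lebesgue_measure_cball.
pose J := [set y : 'rV[R]_n | forall j, `|y ord0 j - c' j| <= r].
have mJ : measurable J by exact: measurable_closed_cube.
apply: (le_trans (@product_measure_le_ysection _ _ _ _ _ _ _ S J
    (2 * h / `|a ord0|)%:E mS mJ _ _ _)).
- by rewrite lee_fin !(mulr_ge0, invr_ge0).
- move=> y _; pose t := \sum_j a' j * (y ord0 j - c' j) + b.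
  pose m := c ord0 - t / a ord0.
  apply: (@le_trans _ _
    (@lebesgue_measure R `[m - h / `|a ord0|, m + h / `|a ord0|]%classic)).
    apply: le_measure; rewrite ?inE.
    + by apply: measurable_ysection.
    + exact: measurable_itv.
    + move=> x; rewrite /ysection/= inE => /SE[_ _ H]; rewrite /= in_itv/= -ler_distl.
      rewrite ler_pdivlMr// -normrM (le_trans _ H)// /m -/t.
      rewrite (_ : (x - (c ord0 - t / a ord0)) * a ord0 = a ord0 * (x - c ord0) + t)//.
      by field.
  by rewrite lebesgue_measure_cball ?divr_ge0// mulrA.
- move=> y yJ; apply/seteqP; split => // x; rewrite /ysection/= inE => /SE[_ H _].
  exact: yJ.
- by rewrite leb_cube// -EFinM mulrC.
Qed.

End slab.

(** * Integral bounds for the kernel *)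

Section kernel.
Context (R : realType) (n : nat) (s : R) (hs : 0 < s).
Implicit Types x y z : 'rV[R]_n.

(** For s > 0 the value at z = 0 is 0, because the positive power of 0 and the inverse of 0 are both
    0; the diagonal is therefore harmless in every bound. *)
Definition kern z : R := (enorm z `^ (n%:R + 2 * s))^-1.

Lemma exponent_gt0 : 0 < n%:R + 2 * s.
Proof. by rewrite ltr_wpDl// mulr_gt0. Qed.

Lemma kern_ge0 z : 0 <= kern z.
Proof. by rewrite invr_ge0 powR_ge0. Qed.

Lemma kernB x y : kern (x - y) = kern (y - x).
Proof. by rewrite /kern enormB. Qed.

Lemma kern_le (r : R) z : 0 < r -> r <= enorm z ->
  kern z <= (r `^ (n%:R + 2 * s))^-1.
Proof.
move=> r0 rz; have z0 := lt_le_trans r0 rz.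
rewrite lef_pV2 ?posrE ?powR_gt0//.
by apply: ge0_ler_powR rz; rewrite ?nnegrE ?(ltW r0) ?(ltW z0) ?(ltW exponent_gt0).
Qed.

Lemma measurable_kern : measurable_fun setT kern.
Proof.
rewrite (_ : kern = fun z => enorm z `^ - (n%:R + 2 * s)).
  exact: (measurableT_comp (measurable_powR (- (n%:R + 2 * s))) (@measurable_enorm R n)).
by apply/funext => z; rewrite powRN.
Qed.

(** On the k-th shell, of outer radius r = r0 b^k, the kernel is at most (r/2)^-(n+2s) and the
    volume at most D r^(n+th), so the shells contribute a geometric series of ratio b^(th-2s). It is
    used with b = 2, th = 0 away from a point, and with b = 1/2, th = 1 near a point. *)
Lemma dyadic_integral_le (x : 'rV[R]_n) (S : set 'rV[R]_n) (r0 b D th : R) :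
  0 < r0 -> 0 < b -> 0 <= D -> b `^ (th - 2 * s) < 1 -> measurable S ->
  (forall y, S y -> y = x \/ exists k : nat,
      r0 * b ^+ k / 2 <= enorm (y - x) <= r0 * b ^+ k) ->
  (forall k : nat, (leb (S `&` [set y | (enorm (y - x) <= r0 * b ^+ k)%R]) <=
     (D * (r0 * b ^+ k) `^ (n%:R + th))%:E)%E) ->
  (\int[leb]_(y in S) (kern (y - x))%:E <=
   (D * 2 `^ (n%:R + 2 * s) / (1 - b `^ (th - 2 * s)) *
    r0 `^ (th - 2 * s))%:E)%E.
Proof.
move=> r00 b0 D0 b1 mS cov vol; set q := n%:R + 2 * s; set e := th - 2 * s.
have q0 : 0 < q := exponent_gt0.
pose rk k := r0 * b ^+ k; have rk0 k : 0 < rk k by rewrite mulr_gt0 ?exprn_gt0.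
pose Sk k := S `&` [set y | enorm (y - x) <= rk k].
have mSk k : measurable (Sk k).
  by apply: measurableI => //; exact: measurable_enorm_le.
pose c k := ((rk k / 2) `^ q)^-1.
have c0 k : 0 <= c k by rewrite invr_ge0 powR_ge0.
pose f k y := (c k * \1_(Sk k) y)%:E.
have f0 k y : (0 <= f k y)%E by rewrite lee_fin mulr_ge0.
have mf k : measurable_fun setT (f k).
  by apply/measurable_EFinP; apply: measurable_funM.
have mK : measurable_fun setT (fun y => (kern (y - x))%:E).
  apply/measurable_EFinP; exact: (measurableT_comp measurable_kern (measurable_subr x)).
have KE : (\int[leb]_(y in S) (kern (y - x))%:E <=
    \int[leb]_y (\sum_(k <oo) f k y))%E.
  rewrite integral_mkcond; apply: ge0_le_integral => //.
  - by move=> y _; rewrite patchE; case: ifP => // _; rewrite lee_fin kern_ge0.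
  - by apply: (measurable_restrictT _ mS).1; exact: (measurable_funTS mK).
  - by apply: ge0_emeasurable_sum.
  move=> y _; rewrite patchE; case: ifPn => [|_]; last exact: nneseries_ge0.
  rewrite inE => Sy; case: (cov _ Sy) => [->|[k /andP[k1 k2]]].
    rewrite subrr /kern (eqP (_ : enorm 0 == 0)) ?enorm_eq0//.
    by rewrite powR0 ?gt_eqF// invr0 nneseries_ge0.
  apply: (@le_trans _ _ (\sum_(0 <= i < k.+1) f i y)%E); last first.
    by apply: nneseries_lim_ge => i _ _; exact: f0.
  rewrite big_nat_recr//=; apply: (@le_trans _ _ (f k y)); last first.
    by rewrite leeDr// sume_ge0.
  rewrite /f lee_fin indicE mem_set// mulr1; apply: kern_le => //.
  by rewrite divr_gt0.
apply: (le_trans KE); rewrite integral_nneseries//.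
have fk k : (\int[leb]_y f k y <= (geometric (D * 2 `^ q * r0 `^ e) (b `^ e) k)%:E)%E.
  rewrite /f; under eq_integral do rewrite EFinM.
  rewrite ge0_integralZl//; last 2 first.
    - by apply/measurable_EFinP.
    - by rewrite lee_fin.
  rewrite integral_indic// setIT.
  apply: (@le_trans _ _ ((c k)%:E * (D * (rk k) `^ (n%:R + th))%:E)%E).
    by apply: lee_wpmul2l; rewrite ?lee_fin//; exact: vol.
  rewrite -EFinM lee_fin le_eqVlt; apply/orP; left; apply/eqP.
  have cE : c k = 2 `^ q / rk k `^ q.
    have : rk k `^ q = (rk k / 2) `^ q * 2 `^ q.
      by rewrite -powRM ?divfK// divr_ge0// ltW.
    rewrite /c => ->; have := powR_gt0 q (rk0 k); have := @powR_gt0 R 2 q (ltr0Sn _ _).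
    have : 0 < (rk k / 2) `^ q by rewrite powR_gt0 ?divr_gt0.
    by move=> h1 h2 h3; field; rewrite !gt_eqF.
  have -> : n%:R + th = q + e by rewrite /q /e; ring.
  rewrite powRD; last by apply/implyP => _; rewrite gt_eqF.
  have -> : rk k `^ e = r0 `^ e * b `^ e ^+ k.
    rewrite /rk powRM ?exprn_ge0 ?(ltW b0) ?(ltW r00)//; congr (_ * _).
    rewrite -(powR_mulrn k (ltW b0)) -(powR_mulrn k (powR_ge0 b e)) -!powRrM.
    by rewrite mulrC.
  rewrite cE; have := powR_gt0 q (rk0 k) => h.
  by rewrite /=; field; rewrite gt_eqF.
apply: (@le_trans _ _ (\sum_(k <oo) (geometric (D * 2 `^ q * r0 `^ e) (b `^ e) k)%:E)%E).
  by apply: lee_nneseries => [i _ _|i _]; [apply: integral_ge0|].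
have be : `|b `^ e| < 1 by rewrite ger0_norm ?powR_ge0.
have := @cvg_geometric_series _ (D * 2 `^ q * r0 `^ e) _ be.
move=> h.
rewrite (_ : (\sum_(k <oo) _)%E = (D * 2 `^ q * r0 `^ e / (1 - b `^ e))%:E).
  by rewrite lee_fin -!mulrA ler_wpM2l// ler_wpM2l ?powR_ge0// mulrC.
apply/cvg_lim => //; rewrite (_ : (fun m => _) =
  EFin \o series (geometric (D * 2 `^ q * r0 `^ e) (b `^ e))).
  by apply: cvg_EFin => //; exact: nearW.
by apply/funext => m /=; rewrite sumEFin.
Qed.

End kernel.

Lemma dyadic_exists (R : realType) (u : R) : 1 <= u ->
  exists k : nat, 2 ^+ k <= u < 2 ^+ k.+1.
Proof.
move=> u1; have u0 : 0 <= u by rewrite (le_trans _ u1).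
have t0 : (0 < Num.truncn u)%N by rewrite truncn_ge_nat.
exists (trunc_log 2 (Num.truncn u)).
have /andP[h1 h2] := trunc_log_bounds (isT : 1 < 2)%N t0.
rewrite -!natrX -truncn_ge_nat// h1/=.
by rewrite -truncn_lt_nat.
Qed.

Lemma powR_gt1 (R : realType) (b e : R) : 1 < b -> 0 < e -> 1 < b `^ e.
Proof.
move=> b1 e0; have b0 : 0 <= b by rewrite (le_trans _ (ltW b1)).
have := gt0_ltr_powR e0; rewrite -[X in X < _ `^ _](congr1 (@^~ e) (powR1 R)).
by apply; rewrite ?nnegrE.
Qed.

Section kernel_bounds.
Context (R : realType) (n : nat) (s : R) (hs0 : 0 < s) (hs1 : s < 1 / 2).
Implicit Types x y : 'rV[R]_n.

(** The shells grow outwards by factors of 2; starting from outer radius [2 * rho], the k-th is rho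
    2^k <= |y - p| <= 2 rho 2^k. Cubes bound the volumes, and the ratio 2^(-2s) is below 1 since s >
    0. *)
Lemma far_integral_lty (p : 'rV[R]_n) (rho : R) : 0 < rho ->
  (\int[leb]_(y in ~` [set y | (enorm (y - p) < rho)%R])
     (kern s (y - p))%:E < +oo)%E.
Proof.
move=> rho0; apply: le_lt_trans (ltry _).
apply: (@dyadic_integral_le _ _ _ hs0 p _ (2 * rho) 2 (2 ^+ n) 0) => //.
- by rewrite mulr_gt0.
- by rewrite sub0r powRN invf_lt1 ?powR_gt0// powR_gt1// ?ltr1n// mulr_gt0.
- exact: measurable_far.
- move=> y /negP; rewrite -leNgt => hy; right.
  have u1 : 1 <= enorm (y - p) / rho by rewrite ler_pdivlMr// mul1r.
  have [k /andP[k1 k2]] := dyadic_exists u1.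
  exists k; move: k1 k2; rewrite ler_pdivlMr// ltr_pdivrMr// exprS => k1 k2.
  by apply/andP; split; lra.
move=> k; set r := 2 * rho * 2 ^+ k.
have r0 : 0 <= r by rewrite !mulr_ge0 ?exprn_ge0// ltW.
rewrite addr0 powR_mulrn// -exprMn -(leb_cube (fun j => p ord0 j) r0).
apply: le_measure; rewrite ?inE.
- by apply: measurableI; [exact: measurable_far|exact: measurable_enorm_le].
- exact: measurable_closed_cube.
- move=> y [_ /= hy] j; have := ler_coord_enorm (y - p) j; rewrite !mxE => h.
  exact: le_trans h hy.
Qed.

(* Value of the dyadic sum that bounds the kernel over the part of a ball of
   radius 1 where |a . z| <= C |z| ^ 2, if some coordinate of a is at least c. *)
Definition near_constant (c C : R) : R :=
  2 ^+ n * (C / c) * 2 `^ (n%:R + 2 * s) / (1 - 2^-1 `^ (1 - 2 * s)).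

(** The shells shrink towards x by factors of 1/2. Within distance r of x the set lies in a slab
    where the linear form is at most C r^2, so its volume is O(r^(n+1)), one power better than that
    of a ball. The ratio 2^-(1-2s) is below 1 since s < 1/2. *)
Lemma near_integral_le x (a : 'I_n -> R) (i : 'I_n) (c C r0 : R)
    (S : set 'rV[R]_n) :
  0 < c -> 0 <= C -> 0 < r0 -> c <= `|a i| -> measurable S ->
  (forall y, S y -> enorm (y - x) <= r0 /\
     `|\sum_j a j * (y ord0 j - x ord0 j)| <= C * enorm (y - x) ^+ 2) ->
  (\int[leb]_(y in S) (kern s (y - x))%:E <=
    (near_constant c C * r0 `^ (1 - 2 * s))%:E)%E.
Proof.
move=> c0 C0 r00 ca mS hS.
have n0 : (0 < n)%N by exact: leq_ltn_trans (leq0n i) (ltn_ord i).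
apply: dyadic_integral_le => //.
- by rewrite !mulr_ge0// ?invr_ge0 ?exprn_ge0// ltW.
- rewrite -powR_inv1// -powRrM mulN1r powRN invf_lt1 ?powR_gt0//.
  rewrite powR_gt1 ?ltr1n//. by rewrite subr_gt0 mulrC -ltr_pdivlMr.
- move=> y Sy; have [yx|yx] := eqVneq y x; [by left|right].
  have e0 : 0 < enorm (y - x) by rewrite lt_def enorm_eq0 subr_eq0 yx enorm_ge0.
  have u1 : 1 <= r0 / enorm (y - x) by rewrite ler_pdivlMr// mul1r (hS _ Sy).1.
  have [k /andP[k1 k2]] := dyadic_exists u1.
  exists k; move: k1 k2; rewrite ler_pdivlMr// ltr_pdivrMr// exprS => k1 k2.
  have k0 : 0 < 2 ^+ k :> R by rewrite exprn_gt0.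
  rewrite exprVn; apply/andP; split.
    by rewrite ler_pdivrMr// ler_pdivrMr// ltW//; lra.
  by rewrite ler_pdivlMr// mulrC.
move=> k; set r := r0 * 2^-1 ^+ k.
have rp : 0 < r by rewrite mulr_gt0 ?exprn_gt0 ?invr_gt0.
have a0 : 0 < `|a i| := lt_le_trans c0 ca.
apply: (@le_trans _ _ (leb (slab a (fun j => x ord0 j) 0 r (C * r ^+ 2)))).
  apply: le_measure; rewrite ?inE.
  - by apply: measurableI => //; exact: measurable_enorm_le.
  - exact: measurable_slab.
  - move=> y [Sy /= yr]; split.
      move=> j; have := ler_coord_enorm (y - x) j; rewrite !mxE => h.
      exact: le_trans h yr.
    rewrite addr0 (le_trans (hS _ Sy).2)// ler_wpM2l//.
    by rewrite ler_pXn2r ?nnegrE ?enorm_ge0// ltW.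
apply: (le_trans (leb_slab_le _ _ _ _ _ (i := i))).
- exact: ltW.
- by rewrite mulr_ge0// exprn_ge0// ltW.
- by rewrite -normr_gt0.
rewrite lee_fin natr1 powR_mulrn ?(ltW rp)//.
have -> : 2 ^+ n * (C / c) * r ^+ n.+1 = (2 * r) ^+ n.-1 * (2 * (C * r ^+ 2) / c).
  have e1 : 2 ^+ n = 2 * 2 ^+ n.-1 :> R by rewrite -exprS prednK.
  have e2 : r ^+ n.+1 = r * (r * r ^+ n.-1) by rewrite -!exprS prednK.
  by rewrite e1 e2 (exprMn _ 2 r); field; rewrite gt_eqF.
rewrite ler_wpM2l ?exprn_ge0 ?mulr_ge0 ?(ltW rp) ?(ltW r00)//.
by rewrite ler_wpM2l ?mulr_ge0 ?exprn_ge0 ?(ltW rp) ?(ltW r00)// lef_pV2.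
Qed.

End kernel_bounds.

Lemma setD_eq_mem T (S B N : set T) x :
  S `\` N = B `\` N -> ~ N x -> S x <-> B x.
Proof.
move=> e Nx; have : (S `\` N) x <-> (B `\` N) x by rewrite e.
by rewrite /setD/=; tauto.
Qed.

Lemma setI_eq_off T (X S B N : set T) :
  S `\` N = B `\` N -> (X `&` S) `\` N = (X `&` B) `\` N.
Proof. by move=> e; rewrite !setDE -!setIA -!setDE e. Qed.

Lemma setC_eq_off T (S B N : set T) :
  S `\` N = B `\` N -> ~` S `\` N = ~` B `\` N.
Proof.
move=> e; apply/seteqP; split => x [h Nx]; have := setD_eq_mem e Nx;
  by split => //; move: h => /=; tauto.
Qed.

(** * Interactions and removal of a subset *)

Section null_sets.
Local Open Scope ereal_scope.
Context d (T : measurableType d) (R : realType)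
  (mu : {measure set T -> \bar R}).

(** No measurability is assumed: integrals of nonnegative functions are suprema over simple
    functions. This allows integration over sets that are only Lebesgue measurable. *)
Lemma ge0_le_integral_sup (f g : T -> \bar R) :
  (forall x, 0 <= f x) -> (forall x, 0 <= g x) ->
  (forall x, f x <= g x) -> \int[mu]_x f x <= \int[mu]_x g x.
Proof.
move=> f0 g0 fg; rewrite !ge0_integralTE//; apply: le_ereal_sup => _ [h hf <-].
by exists h => // x; exact: le_trans (fg x).
Qed.

Lemma ge0_subset_integral_sup (D E : set T) (f : T -> \bar R) :
  (forall x, 0 <= f x) -> D `<=` E ->
  \int[mu]_(x in D) f x <= \int[mu]_(x in E) f x.
Proof.
move=> f0 DE; rewrite [leLHS]integral_mkcond [leRHS]integral_mkcond.
apply: ge0_le_integral_sup => // x; rewrite ?patchE; [by case: ifP..|].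
case: ifPn => [/set_mem /DE|_]; first by move=> /mem_set ->.
by case: ifP.
Qed.

(** W need not be Borel; it is squeezed between [B \ N] and the union of B and N, over which the
    integrals agree. *)
Lemma ge0_integral_eq_off_null (W B N : set T) (f : T -> \bar R) :
  measurable B -> measurable N -> mu N = 0 -> measurable_fun setT f ->
  (forall x, 0 <= f x) -> W `\` N = B `\` N ->
  \int[mu]_(x in W) f x = \int[mu]_(x in B) f x.
Proof.
move=> mB mN N0 mf f0 WB.
have mfD D : measurable_fun D f by exact: measurable_funTS.
apply/eqP; rewrite eq_le; apply/andP; split.
  apply: (@le_trans _ _ (\int[mu]_(x in B `|` N) f x)).
    apply: ge0_subset_integral_sup => // x Wx.
    have [Nx|Nx] := pselect (N x); first by right.
    by left; have : (W `\` N) x by []; rewrite WB => -[].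
  rewrite (ge0_negligible_integral _ _ _ _ N0)//; last exact: measurableU.
  rewrite setDUl setDv setU0.
  by apply: ge0_subset_integral_sup => // x [].
rewrite (ge0_negligible_integral _ _ _ _ N0)// -WB.
by apply: ge0_subset_integral_sup => // x [].
Qed.

End null_sets.

Section symmetric_kernel.
Context (R : realType) (n : nat) (k : 'rV[R]_n * 'rV[R]_n -> R).
Hypotheses (mk : measurable_fun setT k) (k0 : forall z, 0 <= k z)
  (ksym : forall x y, k (x, y) = k (y, x)).

Definition double_integral (W : set ('rV[R]_n * 'rV[R]_n)) : \bar R :=
  (\int[leb \x leb]_(z in W) (k z)%:E)%E.

Let mkE : measurable_fun setT (fun z => (k z)%:E).
Proof. exact/measurable_EFinP. Qed.

Let kE0 z : (0 <= (k z)%:E)%E. Proof. by rewrite lee_fin. Qed.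

Lemma double_integral_ge0 W : (0 <= double_integral W)%E.
Proof. by apply: integral_ge0 => z _; exact: kE0. Qed.

Lemma double_integralU W W' : measurable W -> measurable W' ->
  W `&` W' `<=` set0 ->
  double_integral (W `|` W') = (double_integral W + double_integral W')%E.
Proof.
move=> mW mW' WW'; rewrite /double_integral ge0_integral_setU//.
  exact: measurable_funTS.
by rewrite disj_set2E; apply/eqP/seteqP; split.
Qed.

Lemma le_double_integral W W' : W `<=` W' ->
  (double_integral W <= double_integral W')%E.
Proof. by move=> WW'; exact: ge0_subset_integral_sup. Qed.

Lemma double_integral_iter W : measurable W ->
  double_integral W =
  (\int[leb]_x \int[leb]_(y in [set y | W (x, y)]) (k (x, y))%:E)%E.
Proof.
move=> mW; rewrite /double_integral integral_mkcond fubini_tonelli1.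
- apply: eq_integral => x _; rewrite /fubini_F [RHS]integral_mkcond.
  by apply: eq_integral => y _; rewrite !patchE.
- by apply: (measurable_restrictT _ mW).1; exact: (measurable_funTS mkE).
- by move=> z; rewrite patchE; case: ifP.
Qed.

Lemma double_integral_swap W : measurable W ->
  double_integral [set z | W (z.2, z.1)] = double_integral W.
Proof.
move=> mW.
have mW' : measurable [set z : 'rV[R]_n * 'rV[R]_n | W (z.2, z.1)].
  rewrite (_ : [set z | _] = (fun z => (z.2, z.1)) @^-1` W)//.
  by rewrite -[X in measurable X]setTI; exact: (measurable_swap measurableT).
rewrite double_integral_iter// /double_integral [RHS]integral_mkcond fubini_tonelli2.
- apply: eq_integral => x _; rewrite /fubini_G [LHS]integral_mkcond.
  by apply: eq_integral => y _; rewrite !patchE ksym.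
- by apply: (measurable_restrictT _ mW).1; exact: (measurable_funTS mkE).
- by move=> z; rewrite patchE; case: ifP.
Qed.

End symmetric_kernel.

Section interaction.
Context (R : realType) (n : nat) (s : R) (hs : 0 < s).
Implicit Types (A B S N Omega : set 'rV[R]_n).

Definition pair_kern (z : 'rV[R]_n * 'rV[R]_n) : R := kern s (z.1 - z.2).

Lemma measurable_pair_kern : measurable_fun setT pair_kern.
Proof. exact: (measurableT_comp (@measurable_kern R n s) (@measurable_sub_pair R n)). Qed.

Lemma pair_kern_ge0 z : 0 <= pair_kern z. Proof. exact: kern_ge0. Qed.

Lemma pair_kern_sym x y : pair_kern (x, y) = pair_kern (y, x).
Proof. exact: kernB. Qed.

Local Notation J := (double_integral pair_kern).

Lemma interactionE S1 S2 : interaction s S1 S2 = J (S1 `*` S2).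
Proof. by []. Qed.

Lemma interactionC S1 S2 : measurable S1 -> measurable S2 ->
  interaction s S1 S2 = interaction s S2 S1.
Proof.
move=> m1 m2; rewrite !interactionE -[RHS](double_integral_swap
  measurable_pair_kern pair_kern_ge0 pair_kern_sym (measurableX m2 m1)).
by congr double_integral; apply/seteqP; split => -[x y] /= [].
Qed.

Lemma interaction_eq_off_null S1 S2 B1 B2 N :
  measurable B1 -> measurable B2 -> measurable N -> leb N = 0%E ->
  S1 `\` N = B1 `\` N -> S2 `\` N = B2 `\` N ->
  interaction s S1 S2 = interaction s B1 B2.
Proof.
move=> m1 m2 mN N0 e1 e2.
(* The two products agree off this union of strips, which is null because 0 times infinity is 0. *)
apply: (@ge0_integral_eq_off_null _ _ _ _ _ _ (N `*` setT `|` setT `*` N)).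
- exact: measurableX.
- by apply: measurableU; exact: measurableX.
- apply/eqP; rewrite -measure_le0.
  apply: (le_trans (measureU2 _ _ _)); [exact: measurableX..|].
  have e12 : (leb \x leb)%E (N `*` [set: 'rV[R]_n]) = 0%E.
    transitivity (leb N * leb [set: 'rV[R]_n])%E; first exact: product_measure1E.
    by rewrite N0 mul0e.
  have e21 : (leb \x leb)%E ([set: 'rV[R]_n] `*` N) = 0%E.
    transitivity (leb [set: 'rV[R]_n] * leb N)%E; first exact: product_measure1E.
    by rewrite N0 mule0.
  by move: e12 e21 => /= -> ->; rewrite adde0.
- by apply/measurable_EFinP; exact: measurable_pair_kern.
- by move=> z; rewrite lee_fin pair_kern_ge0.
apply/seteqP; split => -[x y] /= [[h1 h2] /not_orP[/not_andP[Nx|//] /not_andP[//|Ny]]];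
  split; try (by move=> [[]|[]]); split.
- exact/(setD_eq_mem e1 Nx).
- exact/(setD_eq_mem e2 Ny).
- exact/(setD_eq_mem e1 Nx).
- exact/(setD_eq_mem e2 Ny).
Qed.

Lemma sper_eq_off_null S B N Omega :
  measurable B -> measurable Omega -> measurable N -> leb N = 0%E ->
  S `\` N = B `\` N -> sper s S Omega = sper s B Omega.
Proof.
move=> mB mO mN N0 e.
have ec := setC_eq_off e.
have eI C D X : C `\` N = D `\` N -> (C `&` X) `\` N = (D `&` X) `\` N.
  by rewrite !(setIC _ X); exact: setI_eq_off.
by rewrite /sper; congr (_ + _ + _)%E; apply: (interaction_eq_off_null _ _ mN N0);
  rewrite ?setDE; do ?[apply: eI => //|apply: measurableI => //|exact: measurableC].
Qed.

(** The three interactions tile the pairs of a point of B and a point of its complement that are not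
    both outside Omega. *)
Lemma sperE B Omega : measurable B -> measurable Omega ->
  sper s B Omega = J ((B `*` ~` B) `\` (~` Omega `*` ~` Omega)).
Proof.
move=> mB mO; rewrite /sper !interactionE -!double_integralU//.
- congr double_integral; apply/seteqP; split => -[x y] /=.
    by move=> [[[[? ?] [? ?]]|[[? ?] [? ?]]]|[[? ?] [? ?]]]; split => // -[].
  move=> [[Bx By] h]; have [Ox|Ox] := pselect (Omega x);
    have [Oy|Oy] := pselect (Omega y); first by left; left.
  - by left; right.
  - by right.
  - by exfalso; apply: h.
- exact: measurable_pair_kern.
- exact: pair_kern_ge0.
- by apply: measurableU; apply: measurableX;
    do ?[apply: measurableI|apply: measurableD|apply: measurableC].
- by apply: measurableX; do ?[apply: measurableI|apply: measurableD|apply: measurableC].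
- by move=> [x y] /= [[[[? ?] [? ?]]|[[? ?] [? ?]]] [[? ?] [? ?]]].
- exact: measurable_pair_kern.
- exact: pair_kern_ge0.
- by apply: measurableX; do ?[apply: measurableI|apply: measurableD|apply: measurableC].
- by apply: measurableX; do ?[apply: measurableI|apply: measurableD|apply: measurableC].
- by move=> [x y] /= [[[? ?] [? ?]] [[? ?] [? ?]]].
Qed.

(** The pairs in [rest] are common to the perimeters of B and [B \ A]. What remains is A against ~B
    before the removal, and [B \ A] against A after it; all these pairs count because A lies in
    Omega. Finite perimeter makes the common term finite, so that it cancels. *)
Lemma minimality_removal A B Omega : measurable A -> measurable B ->
  measurable Omega -> A `<=` B `&` Omega ->
  (sper s B Omega < +oo)%E -> (sper s B Omega <= sper s (B `\` A) Omega)%E ->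
  (interaction s A (~` B) < +oo)%E /\
  (interaction s A (~` B) <= interaction s A (B `\` A))%E.
Proof.
move=> mA mB mO AB fin le.
have mBA := measurableD mB mA; have mBc := measurableC mB.
have mOO : measurable (~` Omega `*` ~` Omega).
  by apply: measurableX; exact: measurableC.
pose rest := ((B `\` A) `*` ~` B) `\` (~` Omega `*` ~` Omega).
have mrest : measurable rest by apply: measurableD => //; exact: measurableX.
have E1 : sper s B Omega = (interaction s A (~` B) + J rest)%E.
  rewrite sperE// interactionE -double_integralU//.
  - congr double_integral; apply/seteqP; split => -[x y] /=.
      move=> [[Bx By] h]; have [Ax|Ax] := pselect (A x); first by left.
      by right; split.
    move=> [[Ax By]|[[[Bx _] By] h]]; last by split.
    by have [Bx Ox] := AB _ Ax; split => // -[].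
  - exact: measurable_pair_kern.
  - exact: pair_kern_ge0.
  - exact: measurableX.
  - by move=> [x y] /= [[? ?] [[[? ?] ?] ?]].
have E2 : sper s (B `\` A) Omega = (interaction s A (B `\` A) + J rest)%E.
  rewrite sperE// interactionC// interactionE -double_integralU//.
  - congr double_integral; apply/seteqP; split => -[x y] /=.
      move=> [[Bx By] h]; have [Ay|Ay] := pselect (A y); first by left.
      by right; split => //; split => // By'; apply: By; split.
    move=> [[Bx Ay]|[[Bx By] h]]; last by split => //; split => // -[].
    have [By Oy] := AB _ Ay; split; last by move=> [].
    by split => // -[].
  - exact: measurable_pair_kern.
  - exact: pair_kern_ge0.
  - exact: measurableX.
  - by move=> [x y] /= [[? Ay] [[? By] ?]]; apply: By; exact: (AB _ Ay).1.
have r0 : (0 <= J rest)%E by apply: double_integral_ge0; exact: pair_kern_ge0.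
have i0 : (0 <= interaction s A (~` B))%E.
  by rewrite interactionE; apply: double_integral_ge0; exact: pair_kern_ge0.
move: fin le; rewrite E1 E2 => fin le.
have rfin : J rest \is a fin_num.
  by rewrite ge0_fin_numE// (le_lt_trans _ fin)// leeDr.
by split; [rewrite (le_lt_trans _ fin)// leeDl|rewrite -(leeD2rE _ _ rfin)].
Qed.

End interaction.

(** * The one-sided estimate *)

Section truncated_kernel.
Context (R : realType) (n : nat) (s : R) (hs : 0 < s).
Implicit Types x y z : 'rV[R]_n.

Definition kern_trunc (rho : R) z : R :=
  kern s z * \1_[set z | rho <= enorm z] z.

Lemma kern_truncE rho z : rho <= enorm z -> kern_trunc rho z = kern s z.
Proof. by move=> h; rewrite /kern_trunc indicE mem_set// mulr1. Qed.

Lemma kern_trunc_ge0 rho z : 0 <= kern_trunc rho z.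
Proof. by rewrite mulr_ge0// kern_ge0. Qed.

Lemma kern_trunc_le rho z : kern_trunc rho z <= kern s z.
Proof.
rewrite /kern_trunc indicE; case: (_ \in _); rewrite ?mulr1// mulr0.
exact: kern_ge0.
Qed.

Lemma kern_trunc_bounded rho z : 0 < rho ->
  kern_trunc rho z <= (rho `^ (n%:R + 2 * s))^-1.
Proof.
move=> rho0; rewrite /kern_trunc indicE; case: (boolP (_ \in _)) => h.
  rewrite mulr1; apply: kern_le => //; by rewrite inE in h.
by rewrite mulr0 invr_ge0 powR_ge0.
Qed.

Lemma kern_truncN rho z : kern_trunc rho (- z) = kern_trunc rho z.
Proof.
rewrite /kern_trunc /kern !indicE enormN; congr (_ * _%:R).
by congr nat_of_bool; apply/idP/idP; rewrite !inE/= enormN.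
Qed.

Lemma measurable_kern_trunc rho : measurable_fun setT (kern_trunc rho).
Proof.
apply: measurable_funM; first exact: measurable_kern.
apply: measurable_indic; rewrite (_ : [set z | _] =
    (@enorm R n) @^-1` `[rho, +oo[%classic).
  by rewrite -[X in measurable X]setTI; exact: measurable_enorm.
by apply/seteqP; split => y /=; rewrite in_itv/= andbT.
Qed.

(** Far from p, this lets the kernel centred at x be replaced by the one centred at p, at the cost
    of a factor close to 1. *)
Lemma kern_comparison (l : R) z y : 0 < l -> 0 < enorm z -> 0 < enorm y ->
  enorm y <= l * enorm z -> kern s z <= l `^ (n%:R + 2 * s) * kern s y.
Proof.
move=> l0 z0 y0 yz; rewrite /kern ler_pdivlMr ?powR_gt0// mulrC.
rewrite ler_pdivrMr ?powR_gt0// -powRM ?(ltW l0) ?(ltW z0)//.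
by apply: ge0_ler_powR => //; rewrite ?nnegrE ?(ltW y0)//
  ?(ltW (exponent_gt0 n hs))// mulr_ge0 ?ltW.
Qed.

End truncated_kernel.

Section reflection_integral.
Context (R : realType) (n : nat).

Lemma ge0_integral_reflect (c : 'rV[R]_n) (S : set 'rV[R]_n) (f : 'rV[R]_n -> \bar R) :
  measurable S -> measurable_fun setT f -> (forall y, 0 <= f y)%E ->
  (\int[leb]_(y in (fun y => (c - y)%R) @^-1` S) f (c - y)%R = \int[leb]_(y in S) f y)%E.
Proof.
move=> mS mf f0.
rewrite -[LHS](@ge0_integral_pushforward _ _ _ _ _ _ (measurable_subl c) leb S f)//.
  apply: eq_measure_integral => [|mc A mA _]; first exact: measurable_subl.
  exact: (leb_reflect c mA).
exact: (measurable_funTS mf).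
Qed.

End reflection_integral.

Lemma adde_reorder (R : realType) (u v : \bar R) (a b c : R) :
  (a%:E + u + b%:E + c%:E + v = u + v + (c + b + a)%:E)%E.
Proof.
rewrite (addeC a%:E) -!addeA; congr (_ + _)%E.
rewrite [RHS]addeC !addeA; congr (_ + _)%E.
by rewrite -!EFinD; congr EFin; ring.
Qed.

(** * Comparison of the kernel over N and P for one fixed centre x *)

Section pointwise.
Context (R : realType) (n : nat) (s : R) (hs0 : 0 < s) (hs1 : s < 1 / 2).
Variables (p x : 'rV[R]_n) (r d rho : R) (B P N : set 'rV[R]_n)
  (psi : 'rV[R]_n -> R) (a : 'I_n -> R) (i : 'I_n) (c C : R).
Local Notation G := [set y : 'rV[R]_n | enorm (y - p) < r].
Local Notation q := (n%:R + 2 * s).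
Local Notation shell := [set y : 'rV[R]_n | r - 2 * d <= enorm (y - p) < r].
Hypotheses (r0 : 0 < r) (d0 : 0 < d) (dr : 6 * d <= r) (xp : enorm (x - p) <= d).
Hypotheses (rho0 : 0 < rho) (rhor : 2 * rho <= r).
Hypotheses (mB : measurable B) (mP : measurable P) (mN : measurable N).
Hypotheses (NG : forall y, G y -> N y -> psi y < psi x)
  (PG : forall y, G y -> psi x < psi y -> P y).
Hypotheses (Pfar : forall y, ~ G y -> ~ B y -> P y)
  (Nfar : forall y, ~ G y -> N y -> B y).
Hypotheses (c0 : 0 < c) (C0 : 0 <= C) (ca : c <= `|a i|).
Hypothesis taylor : forall y, G y ->
  `|psi y - psi x - \sum_j a j * (y ord0 j - x ord0 j)| <= C * enorm (y - x) ^+ 2.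

Let K y : \bar R := (kern_trunc s rho (y - x))%:E.

Let mK : measurable_fun setT K.
Proof.
apply/measurable_EFinP.
exact: (measurableT_comp (@measurable_kern_trunc R n s rho) (measurable_subr x)).
Qed.

Let mKS S : measurable_fun S K. Proof. exact: (measurable_funTS mK). Qed.

Let K0 y : (0 <= K y)%E. Proof. by rewrite lee_fin kern_trunc_ge0. Qed.

Let mG : measurable G.
Proof. by rewrite -[G]setCK; apply: measurableC; exact: measurable_far. Qed.

Let mGc : measurable (~` G). Proof. exact: measurableC. Qed.

Let mkp S : measurable_fun S (fun y : 'rV[R]_n => (kern s (y - p))%:E).
Proof.
apply: measurable_funTS; apply/measurable_EFinP.
exact: (measurableT_comp (@measurable_kern R n s) (measurable_subr p)).
Qed.

Let kp0 y : (0 <= (kern s (y - p))%:E)%E. Proof. by rewrite lee_fin kern_ge0. Qed.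

Let ratio_gt0 : 0 < r / (r - d).
Proof. by move: (r0) (d0) (dr) => ? ? ?; rewrite divr_gt0//; lra. Qed.

(** Since |x - p| <= d and |y - p| >= r, the distances of y to x and to p differ by at most d and
    are both at least r - d; so their ratio is at most 1 + d/(r - d) = r/(r - d) in either order. *)
Let dist_far y : ~ G y ->
  [/\ 0 < enorm (y - x), 0 < enorm (y - p), rho <= enorm (y - x),
  enorm (y - x) <= r / (r - d) * enorm (y - p) &
  enorm (y - p) <= r / (r - d) * enorm (y - x)].
Proof.
move=> /negP; rewrite -leNgt => hy.
have h1 := ler_enorm_dist y p x; rewrite (enormB p x) in h1.
have h2 := ler_enorm_dist y x p.
move: (r0) (d0) (dr) (xp) (rho0) (rhor) => r0' d0' dr' xp' rho0' rhor'.
have rd : 0 < r - d by lra.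
split; try lra.
  by rewrite mulrAC ler_pdivlMr//; nra.
by rewrite mulrAC ler_pdivlMr//; nra.
Qed.

Lemma far_le_integral_P : (\int[leb]_(y in ~` G `&` ~` B) (kern s (y - p))%:E <=
  ((r / (r - d)) `^ q)%:E * \int[leb]_(y in P `\` G) K y)%E.
Proof.
have rd := ratio_gt0.
rewrite -ge0_integralZl//; last 2 first.
- exact: measurableD.
- by rewrite lee_fin powR_ge0.
have mS : measurable (~` G `&` ~` B) by apply: measurableI => //; exact: measurableC.
apply: (@le_trans _ _ (\int[leb]_(y in ~` G `&` ~` B)
    (((r / (r - d)) `^ q)%:E * K y))%E).
  apply: ge0_le_integral => //.
    exact: measurable_funeM.
  move=> y [Gy _]; have [h1 h2 h3 h4 h5] := dist_far Gy.
  by rewrite /K kern_truncE// -EFinM lee_fin; exact: kern_comparison.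
apply: ge0_subset_integral => //; first exact: measurableD.
- exact: measurable_funeM.
- by move=> y _; rewrite mule_ge0// lee_fin powR_ge0.
by move=> y [Gy By]; split => //; exact: Pfar.
Qed.

Lemma integral_N_le_far : (\int[leb]_(y in N `\` G) K y <=
  ((r / (r - d)) `^ q)%:E * \int[leb]_(y in ~` G `&` B) (kern s (y - p))%:E)%E.
Proof.
have rd := ratio_gt0.
have mS : measurable (~` G `&` B) by apply: measurableI.
rewrite -ge0_integralZl//; last by rewrite lee_fin powR_ge0.
have h : (\int[leb]_(y in N `\` G) K y <= \int[leb]_(y in ~` G `&` B) K y)%E.
  apply: ge0_subset_integral => //; first exact: measurableD.
  by move=> y [Ny Gy]; split => //; exact: Nfar.
apply: (le_trans h).
apply: ge0_le_integral => //; first exact: measurable_funeM.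
move=> y [Gy _]; have [h1 h2 h3 h4 h5] := dist_far Gy.
by rewrite /K kern_truncE// -EFinM lee_fin; exact: kern_comparison.
Qed.

(** The reflection at x is usable only where it stays in G, since [taylor] is known only there. *)
Let sym := G `&` (fun y => x + x - y) @^-1` G.

Let msym : measurable sym.
Proof.
by apply: measurableI => //; rewrite -[X in measurable X]setTI; exact: measurable_subl.
Qed.

(** Here the Taylor error may outweigh the linear part, so reflecting y need not move it to the
    other side of the level set. *)
Let bad := [set y : 'rV[R]_n |
  `|\sum_j a j * (y ord0 j - x ord0 j)| <= C * enorm (y - x) ^+ 2].

Let mbad : measurable bad.
Proof.
rewrite (_ : bad = (fun y : 'rV[R]_n => `|\sum_j a j * (y ord0 j - x ord0 j)|
    - C * enorm (y - x) ^+ 2) @^-1` `]-oo, 0]%classic); last first.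
  by apply/seteqP; split => y /=; rewrite in_itv/= subr_le0.
rewrite -[X in measurable X]setTI.
have m1 : measurable_fun setT
    (fun y : 'rV[R]_n => `|\sum_j a j * (y ord0 j - x ord0 j)|).
  apply: measurableT_comp => //; apply: measurable_sum => j.
  apply: measurable_funM => //.
  by apply: measurable_funB => //; exact: measurable_coord.
have m2 : measurable_fun setT (fun y : 'rV[R]_n => C * enorm (y - x) ^+ 2).
  apply: measurable_funM => //; apply: measurable_funX.
  exact: (measurableT_comp (@measurable_enorm R n) (measurable_subr x)).
exact: measurable_funB.
Qed.

Lemma integral_near_bad_le : (\int[leb]_(y in (N `&` sym) `&` bad) K y <=
  (near_constant n s c C * (2 * r) `^ (1 - 2 * s))%:E)%E.
Proof.
have mS : measurable ((N `&` sym) `&` bad) by do 2?apply: measurableI.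
apply: (@le_trans _ _ (\int[leb]_(y in (N `&` sym) `&` bad) (kern s (y - x))%:E)%E).
  apply: ge0_le_integral; [exact: mS|by move=> y _; exact: K0|exact: mKS| |].
    apply: measurable_funTS; apply/measurable_EFinP.
    exact: (measurableT_comp (@measurable_kern R n s) (measurable_subr x)).
  by move=> y _; rewrite lee_fin kern_trunc_le.
(* The radius [2 * r] suffices because |y - x| < r + d for y in G. *)
have r20 : 0 < 2 * r by rewrite mulr_gt0.
apply: (near_integral_le hs0 hs1 c0 C0 r20 ca mS).
move=> y [[_ [Gy _]] bady]; split => //.
have := ler_enorm_dist y p x; rewrite (enormB p x) => h.
by move: Gy (d0) (dr) (xp) => /= *; lra.
Qed.

(* The reflection y -> 2x - y maps the set on the left into P: off bad, the linear
   part of psi - psi x dominates the error term. *)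
Lemma integral_near_good_le : (\int[leb]_(y in (N `&` sym) `\` bad) K y <=
  \int[leb]_(y in P `&` G) K y)%E.
Proof.
have mS : measurable ((N `&` sym) `\` bad).
  by apply: measurableD => //; apply: measurableI.
rewrite -(ge0_integral_reflect (x + x) mS mK K0).
have KR y : K (x + x - y) = K y.
  rewrite /K (_ : x + x - y - x = - (y - x)) ?kern_truncN//.
  by rewrite addrAC addrK opprB.
under eq_integral do rewrite KR.
apply: ge0_subset_integral => //.
- by rewrite -[X in measurable X]setTI; exact: measurable_subl.
- exact: measurableI.
move=> y [[Ny [G1 G2]] by_]; have {}G2 : G y.
  by move: G2 => /=; rewrite subKr.
split => //; apply: PG => //.
have := NG G1 Ny; have := taylor G2; have := taylor G1.
move: by_ => /negP; rewrite /bad/= -ltNge.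
have -> : x + x - y - x = - (y - x) by rewrite addrAC addrK opprB.
rewrite enormN.
have -> : \sum_j a j * ((x + x - y) ord0 j - x ord0 j) =
    - \sum_j a j * (y ord0 j - x ord0 j).
  by rewrite -sumrN; apply: eq_bigr => j _; rewrite !mxE; ring.
set S := \sum_j _; set Q := C * _; rewrite normrN => h1.
rewrite !ler_norml => /andP[h2 h3] /andP[h4 h5] h6.
have [S0|S0] := leP 0 S; first by rewrite ger0_norm// in h1; lra.
by rewrite ltr0_norm// in h1; lra.
Qed.

(** If the reflection of y leaves G, then |y - x| >= r - d. Hence |y - p| >= r - 2d, which puts y in
    the shell, and |y - x| >= r/2, which bounds the kernel. *)
Lemma integral_near_shell_le (sh : R) : (leb shell <= sh%:E)%E ->
  (\int[leb]_(y in (N `&` G) `\` sym) K y <= (((r / 2) `^ q)^-1 * sh)%:E)%E.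
Proof.
move=> hsh.
have mshell : measurable shell by exact: measurable_shell.
have mS : measurable ((N `&` G) `\` sym).
  by apply: measurableD => //; apply: measurableI.
rewrite EFinM; apply: (@le_trans _ _ (((r / 2) `^ q)^-1%:E * leb shell)%E); last first.
  by apply: lee_wpmul2l => //; rewrite lee_fin invr_ge0 powR_ge0.
rewrite -integral_cst//.
apply: (@le_trans _ _ (\int[leb]_(y in (N `&` G) `\` sym)
    (((r / 2) `^ q)^-1%:E))%E).
  apply: ge0_le_integral => //.
  move=> y [[_ Gy] hy]; rewrite lee_fin.
  apply: (le_trans (kern_trunc_le _ _ _)); apply: kern_le => //.
    by rewrite divr_gt0.
  have {}hy : ~ G (x + x - y) by move=> h; apply: hy.
  move: hy => /negP; rewrite -leNgt => hy.
  have := ler_enorm_dist (x + x - y) x p.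
  rewrite (_ : x + x - y - x = - (y - x)) ?enormN; last by rewrite addrAC addrK opprB.
  by move: (d0) (dr) (xp) => *; lra.
apply: ge0_subset_integral => //; first by move=> y _; rewrite lee_fin invr_ge0 powR_ge0.
move=> y [[_ Gy] hy] /=; rewrite Gy andbT.
have {}hy : ~ G (x + x - y) by move=> h; apply: hy.
move: hy => /negP; rewrite -leNgt => hy.
have h1 := ler_enorm_dist (x + x - y) x p.
have h2 := ler_enorm_dist y p x.
move: h1; rewrite (_ : x + x - y - x = - (y - x)) ?enormN; last first.
  by rewrite addrAC addrK opprB.
by rewrite (enormB p x) in h2; move: (xp) => *; lra.
Qed.

(** N is cut into four pieces: outside G, where the centre can be moved to p; in G with reflection
    outside G, which is a thin shell; in [sym] and [bad], small by the dyadic bound; in [sym] off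
    [bad], whose reflection lies in P. None of the errors depends on [rho], and they are uniform in
    x. *)
Lemma pointwise_le (sh l PP NN : R) :
  (leb shell <= sh%:E)%E -> (r / (r - d)) `^ q <= l ->
  (PP%:E <= \int[leb]_(y in ~` G `&` ~` B) (kern s (y - p))%:E)%E ->
  (\int[leb]_(y in ~` G `&` B) (kern s (y - p))%:E <= NN%:E)%E ->
  (\int[leb]_(y in N) (kern_trunc s rho (y - x))%:E + (PP / l)%:E <=
   \int[leb]_(y in P) (kern_trunc s rho (y - x))%:E +
   (l * NN + ((r / 2) `^ q)^-1 * sh +
    near_constant n s c C * (2 * r) `^ (1 - 2 * s))%:E)%E.
Proof.
move=> hsh hl hPP hNN.
have rd := ratio_gt0.
have l0 : 0 < l by rewrite (lt_le_trans _ hl)// powR_gt0.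
have split_int (S T : set 'rV[R]_n) : measurable S -> measurable T ->
    (\int[leb]_(y in S) K y =
     \int[leb]_(y in S `&` T) K y + \int[leb]_(y in S `\` T) K y)%E.
  move=> mS mT; rewrite -ge0_integral_setU ?setUIDK//.
  - exact: measurableI.
  - exact: measurableD.
  - by rewrite disj_set2E; apply/eqP/seteqP; split => // y [[_ Ty] [_ nTy]].
have mNG : measurable (N `&` G) by exact: measurableI.
rewrite -/(\int[leb]_(y in N) K y)%E -/(\int[leb]_(y in P) K y)%E.
rewrite (split_int N G)// (split_int (N `&` G) sym)//.
rewrite (_ : N `&` G `&` sym = N `&` sym); last first.
  by rewrite /sym setIA -setIA; apply/seteqP; split => y [] => [[? ?]|?] [].
rewrite (split_int (N `&` sym) bad)//; last exact: measurableI.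
rewrite (split_int P G)//.
have b1 := integral_near_bad_le; have b2 := integral_near_good_le; have b3 := integral_near_shell_le hsh.
have b4 := integral_N_le_far; have b5 := far_le_integral_P.
set IG := (\int[leb]_(y in P `&` G) K y)%E in b2 *.
set IP := (\int[leb]_(y in P `\` G) K y)%E in b5 *.
have f1 : (\int[leb]_(y in N `\` G) K y <= (l * NN)%:E)%E.
  apply: (le_trans b4); rewrite EFinM; apply: lee_pmul => //.
  - by rewrite lee_fin powR_ge0.
  - exact: integral_ge0.
have f2 : ((PP / l)%:E <= IP)%E.
  have IP0 : (0 <= IP)%E by exact: integral_ge0.
  have : (PP%:E <= l%:E * IP)%E.
    apply: (le_trans hPP); apply: (le_trans b5).
    by apply: lee_wpmul2r => //; rewrite lee_fin.
  by rewrite mulrC EFinM lee_pdivrMl.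
apply: (@le_trans _ _ (((near_constant n s c C * (2 * r) `^ (1 - 2 * s))%:E + IG +
   (((r / 2) `^ q)^-1 * sh)%:E + (l * NN)%:E) + IP)%E).
  by do 4?apply: leeD.
by rewrite adde_reorder.
Qed.

End pointwise.

(** * How small d must be *)

Section choice_of_radius.
Context (R : realType) (n : nat).

Lemma enorm_ball_bounded (p : 'rV[R]_n) (r : R) (S : set 'rV[R]_n) :
  measurable S -> 0 <= r -> (forall y, S y -> enorm (y - p) <= r) ->
  (leb S < +oo)%E.
Proof.
move=> mS r0 Sr; apply: (@le_lt_trans _ _
  (leb [set y : 'rV[R]_n | forall j, `|y ord0 j - p ord0 j| <= r])); last first.
  by rewrite leb_cube// ltry.
apply: le_measure; rewrite ?inE//.
- exact: measurable_closed_cube.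
- move=> y /Sr hy j; have := ler_coord_enorm (y - p) j; rewrite !mxE => h.
  exact: le_trans h hy.
Qed.

(** The shells with d' = 1/(k+1) have finite measure and decrease to the empty set, the sphere of
    radius r being excluded; continuity from above applies. *)
Lemma exists_small_shell (p : 'rV[R]_n) (r sh : R) : 0 < r -> 0 < sh ->
  exists2 d, 0 < d & forall d', 0 < d' <= d ->
    (leb [set y : 'rV[R]_n | (r - 2 * d' <= enorm (y - p) < r)%R] <= sh%:E)%E.
Proof.
move=> r0 sh0.
pose F k := [set y : 'rV[R]_n | r - 2 / k.+1%:R <= enorm (y - p) < r].
have mF k : measurable (F k) by exact: measurable_shell.
have F0 : \bigcap_k F k = set0.
  apply/seteqP; split => // y hy.
  have yr : enorm (y - p) < r by have /andP[] := hy 0%N I.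
  pose u := (r - enorm (y - p)) / 2.
  have u0 : 0 < u by rewrite divr_gt0// subr_gt0.
  have : u^-1 < (Num.truncn u^-1).+1%:R by rewrite truncnS_gt.
  set k := Num.truncn _ => hk; have /andP[hk' _] := hy k I; move: hk'.
  have k0 : 0 < k.+1%:R :> R by [].
  have : k.+1%:R^-1 < u by rewrite invf_plt ?posrE.
  move: yr (r0); rewrite /u; set v := k.+1%:R^-1 => *; lra.
have cF : leb (F k) @[k --> \oo] --> 0%E.
  rewrite -(measure0 (leb (n := n) (R := R))) -F0; apply: nonincreasing_cvg_mu => //.
  - apply: (@enorm_ball_bounded p r); [exact: mF|exact: ltW|].
    by move=> y /andP[_ /ltW].
  - exact: bigcapT_measurable.
  - move=> m k mk; apply/subsetPset => y; rewrite /F/= => /andP[h1 h2].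
    apply/andP; split => //; apply: le_trans h1; rewrite lerD2l lerN2 ler_wpM2l//.
    by rewrite lef_pV2 ?posrE// ler_nat.
have [k hk] : exists k, (leb (F k) <= sh%:E)%E.
  have : \forall k \near \oo, (leb (F k) < sh%:E)%E.
    apply: (cF [set y | (y < sh%:E)%E]); apply: open_nbhs_nbhs.
    by split; [exact: open_ereal_lt_ereal|rewrite /= lte_fin].
  by move=> [k _ /(_ k (leqnn k))] /ltW h; exists k.
exists k.+1%:R^-1 => // d' /andP[d0 dk]; apply: le_trans hk.
apply: le_measure; rewrite ?inE//; first exact: measurable_shell.
move=> y /= /andP[h1 h2]; apply/andP; split => //.
move: dk h1; set v := k.+1%:R^-1 => *; lra.
Qed.

Lemma exists_ratio (r q l : R) : 0 < r -> 0 < q -> 1 < l ->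
  exists2 d, 0 < d & forall d', 0 < d' <= d -> (r / (r - d')) `^ q <= l.
Proof.
move=> r0 q0 l1; have l0 : 0 < l by rewrite (lt_trans _ l1).
pose L := l `^ q^-1; have L1 : 1 < L by rewrite powR_gt1// invr_gt0.
have L0 : 0 < L by rewrite (lt_trans _ L1).
have LV1 : L^-1 < 1 by rewrite invf_lt1.
(* With L = l^(1/q), the bound r/(r - d') <= L is equivalent to d' <= r (1 - 1/L). *)
exists (r * (1 - L^-1)); first by rewrite mulr_gt0// subr_gt0.
move=> d' /andP[d0 dd].
have LV0 : 0 < L^-1 by rewrite invr_gt0.
have rd : 0 < r - d' by nra.
have rL : r / (r - d') <= L.
  rewrite ler_pdivrMr// -ler_pdivrMl//; lra.
rewrite (_ : l = L `^ q); last by rewrite /L -powRrM mulVf ?gt_eqF// powRr1// ltW.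
by apply: ge0_ler_powR;
  rewrite ?nnegrE ?(ltW q0) ?divr_ge0 ?(ltW r0) ?(ltW rd) ?(ltW L0).
Qed.

End choice_of_radius.

Section strict_gain.
Context (R : realType) (n : nat) (k : 'rV[R]_n * 'rV[R]_n -> R).
Hypotheses (mk : measurable_fun setT k) (k0 : forall z, 0 <= k z)
  (ksym : forall x y, k (x, y) = k (y, x)).
Variables (A B : set 'rV[R]_n) (V : set ('rV[R]_n * 'rV[R]_n)) (D e : R).
Hypotheses (kD : forall z, k z <= D) (D0 : 0 <= D) (e0 : 0 <= e).
Hypotheses (mA : measurable A) (mB : measurable B) (mV : measurable V).
Hypotheses (AB : A `<=` B) (Afin : (leb A < +oo)%E).
Hypothesis VA : V `<=` A `*` A.

(* V and its transpose have the same finite double integral, which cancels. *)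
Lemma double_integral_strict_gain :
  (forall x, A x ->
    (\int[leb]_(y in [set y | (B y /\ ~ A y) \/ V (y, x)]) (k (x, y))%:E + e%:E <=
     \int[leb]_(y in [set y | ~ B y \/ V (x, y)]) (k (x, y))%:E)%E) ->
  (double_integral k (A `*` (B `\` A)) + e%:E * leb A <=
   double_integral k (A `*` ~` B))%E.
Proof.
move=> H.
have mV' : measurable [set z : 'rV[R]_n * 'rV[R]_n | V (z.2, z.1)].
  rewrite (_ : [set z | _] = (fun z => (z.2, z.1)) @^-1` V)//.
  by rewrite -[X in measurable X]setTI; exact: (measurable_swap measurableT).
set V' := [set z | V (z.2, z.1)] in mV'.
have mkE : measurable_fun setT (fun z => (k z)%:E) by exact/measurable_EFinP.
pose WN := (A `*` (B `\` A)) `|` V'; pose WP := (A `*` ~` B) `|` V.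
have mABA : measurable (A `*` (B `\` A)).
  by apply: measurableX => //; exact: measurableD.
have mABc : measurable (A `*` ~` B).
  by apply: measurableX => //; exact: measurableC.
have mWN : measurable WN by exact: measurableU.
have mWP : measurable WP by exact: measurableU.
have gain : (double_integral k WN + e%:E * leb A <= double_integral k WP)%E.
  rewrite !double_integral_iter//.
  have mF W : measurable W ->
      measurable_fun setT (fun x => \int[leb]_(y in [set y | W (x, y)]) (k (x, y))%:E)%E.
    move=> mW; rewrite (_ : (fun x => _) =
        fubini_F leb ((fun z => (k z)%:E) \_ W)).
      apply: measurable_fun_fubini_tonelli_F.
        by apply: (measurable_restrictT _ mW).1; exact: (measurable_funTS mkE).
      by move=> z; rewrite patchE; case: ifP => // _; rewrite lee_fin.
    apply/funext => x; rewrite /fubini_F [LHS]integral_mkcond.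
    by apply: eq_integral => y _; rewrite !patchE.
  have F0 W x : (0 <= \int[leb]_(y in [set y | W (x, y)]) (k (x, y))%:E)%E.
    by apply: integral_ge0 => y _; rewrite lee_fin.
  have -> : (e%:E * leb A = \int[leb]_x (e * \1_A x)%:E)%E.
    under eq_integral do rewrite EFinM.
    rewrite ge0_integralZl//; last by apply/measurable_EFinP.
    by rewrite integral_indic// setIT.
  have meA : measurable_fun setT (fun x : 'rV[R]_n => (e * \1_A x)%:E).
    by apply/measurable_EFinP; apply: measurable_funM.
  rewrite -ge0_integralD//; last 2 first.
    - exact: mF.
    - by move=> x _; rewrite lee_fin mulr_ge0.
  apply: ge0_le_integral => //.
  - by move=> x _; rewrite adde_ge0// lee_fin mulr_ge0.
  - by apply: emeasurable_funD => //; exact: mF.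
  - exact: mF.
  move=> x _; rewrite indicE; have [Ax|Ax] := pselect (A x).
    rewrite mem_set// mulr1.
    rewrite (_ : [set y | WN (x, y)] = [set y | (B y /\ ~ A y) \/ V (y, x)]); last first.
      by apply/seteqP; split => y; rewrite /WN/=; tauto.
    rewrite (_ : [set y | WP (x, y)] = [set y | ~ B y \/ V (x, y)]); last first.
      by apply/seteqP; split => y; rewrite /WP/=; tauto.
    exact: H.
  rewrite memNset// mulr0 adde0 (_ : [set y | WN (x, y)] = set0) ?integral_set0//.
  by apply/seteqP; split => // y [[/= /Ax]|/VA[_ /Ax]].
have dV0 W : (0 <= double_integral k W)%E by exact: double_integral_ge0.
have Vfin : double_integral k V \is a fin_num.
  rewrite ge0_fin_numE//; apply: (@le_lt_trans _ _ (D%:E * (leb A * leb A))%E); last first.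
     have AA : (leb A * leb A < +oo)%E.
      by apply: lte_mul_pinfty => //; rewrite ge0_fin_numE.
    exact: lte_mul_pinfty AA.
  apply: (@le_trans _ _ (double_integral k (A `*` A))).
    exact: le_double_integral.
  have mAA : measurable (A `*` A) by exact: measurableX.
  have <- : (leb \x leb)%E (A `*` A) = (leb A * leb A)%E by exact: product_measure1E.
  rewrite -integral_cst//; apply: ge0_le_integral => //.
  - by move=> z _; rewrite lee_fin.
  - exact: (measurable_funTS mkE).
  - by move=> z _; rewrite lee_fin.
rewrite -(leeD2rE _ _ Vfin) addeAC.
rewrite -[X in (_ + X + _ <= _)%E](double_integral_swap mk k0 ksym mV).
rewrite -!double_integralU//.
  by move=> [x y] /= [[Ax By] Vxy]; apply: By; apply: AB; have [] := VA Vxy.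
by move=> [x y] /= [[Ax [_ nAy]] Vyx]; apply: nAy; have [] := VA Vyx.
Qed.

End strict_gain.

(** * Letting the truncation radius tend to 0 *)

Section truncation_limit.
Context (R : realType) (n : nat) (s : R) (hs : 0 < s).

Lemma kern_trunc_mono (r1 r2 : R) (z : 'rV[R]_n) : r2 <= r1 ->
  kern_trunc s r1 z <= kern_trunc s r2 z.
Proof.
move=> r21; have [h|h] := leP r1 (enorm z).
  by rewrite !kern_truncE// (le_trans r21).
rewrite {1}/kern_trunc indicE memNset ?mulr0 ?kern_trunc_ge0//=.
by apply/negP; rewrite -ltNge.
Qed.

Definition pair_kern_trunc (rho : R) (z : 'rV[R]_n * 'rV[R]_n) : R :=
  kern_trunc s rho (z.1 - z.2).

Lemma measurable_pair_kern_trunc rho : measurable_fun setT (pair_kern_trunc rho).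
Proof.
exact: (measurableT_comp (@measurable_kern_trunc R n s rho) (@measurable_sub_pair R n)).
Qed.

Lemma pair_kern_trunc_sym rho x y :
  pair_kern_trunc rho (x, y) = pair_kern_trunc rho (y, x).
Proof. by rewrite /pair_kern_trunc/= -kern_truncN opprB. Qed.

(** Monotone convergence: as m grows the truncated kernels increase to the full kernel, also on the
    diagonal, where all of them are 0. *)
Lemma interaction_le_of_trunc (S1 S2 : set 'rV[R]_n)
    (r : R) (c : \bar R) :
  measurable S1 -> measurable S2 -> 0 < r ->
  (forall m : nat, (double_integral (pair_kern_trunc (r / m.+1%:R)) (S1 `*` S2) <= c)%E) ->
  (interaction s S1 S2 <= c)%E.
Proof.
move=> m1 m2 r0 H.
have mS : measurable (S1 `*` S2) by exact: measurableX.
have rmono a b : (a <= b)%N -> r / b.+1%:R <= r / a.+1%:R.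
  by move=> ab; rewrite ler_wpM2l ?(ltW r0)// lef_pV2 ?posrE// ler_nat.
have rm m : 0 < r / m.+1%:R by rewrite divr_gt0.
have lim z : (fun m => (pair_kern_trunc (r / m.+1%:R) z)%:E) @ \oo --> (pair_kern s z)%:E.
  have [z0|z0] := eqVneq (enorm (z.1 - z.2)) 0.
    have kz : pair_kern s z = 0.
      by rewrite /pair_kern /kern z0 powR0 ?invr0// gt_eqF// exponent_gt0.
    rewrite kz (_ : (fun m => _) = cst 0%E); first exact: cvg_cst.
    apply/funext => m; congr EFin; apply/eqP; rewrite eq_le kern_trunc_ge0 andbT.
    by rewrite (le_trans (kern_trunc_le _ _ _))// -kz.
  have zp : 0 < enorm (z.1 - z.2) by rewrite lt_def z0 enorm_ge0.
  apply: cvg_near_cst; exists (Num.truncn (r / enorm (z.1 - z.2))) => // m /= hm.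
  rewrite /pair_kern_trunc kern_truncE// ler_pdivrMr// mulrC -ler_pdivrMr//.
  by rewrite ltW// (lt_le_trans (truncnS_gt _))// ler_nat.
rewrite interactionE /double_integral.
rewrite (eq_integral
  (fun z => limn (fun m => (pair_kern_trunc (r / m.+1%:R) z)%:E))); last first.
  by move=> z _; apply/esym/cvg_lim => //; exact: lim.
rewrite monotone_convergence//.
- apply: lime_le; last exact: nearW.
  apply: ereal_nondecreasing_is_cvgn => a b ab.
  apply: ge0_le_integral => //.
  + by move=> z _; rewrite lee_fin kern_trunc_ge0.
  + by apply: measurable_funTS; apply/measurable_EFinP; exact: measurable_pair_kern_trunc.
  + by apply: measurable_funTS; apply/measurable_EFinP; exact: measurable_pair_kern_trunc.
  move=> z _; rewrite lee_fin; exact/kern_trunc_mono/rmono.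
- move=> m; apply: measurable_funTS; apply/measurable_EFinP.
  exact: measurable_pair_kern_trunc.
- by move=> m z _; rewrite lee_fin kern_trunc_ge0.
- by move=> z _ a b ab; rewrite lee_fin; exact/kern_trunc_mono/rmono.
Qed.

End truncation_limit.

Section balls.
Context (R : realType) (n : nat).

Lemma open_eball (p : 'rV[R]_n) (r : R) : open [set y : 'rV[R]_n | enorm (y - p) < r].
Proof.
rewrite openE => y /= yr; apply/nbhs_ballP.
(* The comparison constant of the two norms is taken as n + 1, since n may be 0. *)
have e0 : 0 < (r - enorm (y - p)) / n.+1%:R by rewrite divr_gt0// subr_gt0.
exists ((r - enorm (y - p)) / n.+1%:R) => //= z; rewrite -ball_normE/= => yz.
apply: (le_lt_trans (ler_enorm_dist z y p)).
rewrite -ltrBrDr enormB (le_lt_trans (enorm_le_norm _))//.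
apply: (@le_lt_trans _ _ (n.+1%:R * `|y - z|)).
  by rewrite ler_wpM2r// ler_nat.
by rewrite mulrC -ltr_pdivlMr.
Qed.

Lemma leb_open_gt0 (O : set 'rV[R]_n) x : open O -> O x -> (0 < leb O)%E.
Proof.
move=> oO Ox; have /nbhs_ballP[e/= e0 xe] : nbhs x O by exact: open_nbhs_nbhs.
apply: (@lt_le_trans _ _
  (leb [set y : 'rV[R]_n | forall j, `|y ord0 j - x ord0 j| <= e / 2])).
  by rewrite leb_cube ?lte_fin ?exprn_gt0 ?mulr_gt0// ltW// divr_gt0.
apply: le_measure; rewrite ?inE; last 1 first.
- move=> y hy; apply: xe; rewrite -ball_normE/= (norm_lt_coord _ e0).
  apply/forallP => j; rewrite !mxE distrC (le_lt_trans (hy j))//.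
  by rewrite ltr_pdivrMr// ltr_pMr// ltr1n.
- exact: measurable_closed_cube.
- exact: open_measurable_rV.
Qed.

Lemma open_preimage_in (G : set 'rV[R]_n) (f : 'rV[R]_n -> R) (U : set R) :
  open G -> (forall y, G y -> {for y, continuous f}) -> open U ->
  open (G `&` f @^-1` U).
Proof.
move=> oG cf oU; rewrite openE => y [Gy Uy]; apply: filterI.
  exact: open_nbhs_nbhs.
by apply: (cf _ Gy); exact: open_nbhs_nbhs.
Qed.

Lemma measurable_fun_of_continuous_in (G : set 'rV[R]_n) (f : 'rV[R]_n -> R) :
  open G -> (forall y, G y -> {for y, continuous f}) -> measurable_fun G f.
Proof.
move=> oG cf; apply: (measurability (@RGenOInfty.G R)).
  exact: RGenOInfty.measurableE.
move=> _ [_ [b ->] <-]; apply: open_measurable_rV.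
exact: open_preimage_in.
Qed.

End balls.

Lemma adde_cancel (R : realType) (u v : \bar R) (x y e : R) :
  e <= x - y -> (u + x%:E <= v + y%:E)%E -> (u + e%:E <= v)%E.
Proof.
move=> exy uv; rewrite -(leeD2rE _ _ (_ : y%:E \is a fin_num))//.
apply: le_trans uv; rewrite -addeA; apply: leeD2l.
by rewrite -EFinD lee_fin; lra.
Qed.

Section one_sided.
Context (R : realType) (n : nat).
Implicit Types (p x y : 'rV[R]_n) (phi : 'rV[R]_n -> R).

(** A step of length h from p along coordinate [i], against the sign of [a i], changes phi by -h b
    up to C h^2, where b = |a i|. The bound on h by b/(2(C+1)) keeps phi negative; the bounds by 1
    and t/(b+C+1) keep it above -t. This is what gives the removed set A positive measure. *)
Lemma exists_near_negative p phi (a : 'I_n -> R) (i : 'I_n) (r1 C t d : R) :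
  0 < r1 -> 0 <= C -> a i != 0 -> phi p = 0 ->
  (forall y, enorm (y - p) < r1 ->
    `|phi y - phi p - \sum_j a j * (y ord0 j - p ord0 j)| <= C * enorm (y - p) ^+ 2) ->
  0 < t -> 0 < d ->
  exists x, [/\ enorm (x - p) < d, enorm (x - p) < r1 & - t < phi x < 0].
Proof.
move=> r0 C0 ai phip ta t0 d0.
pose b := `|a i|; have b0 : 0 < b by rewrite normr_gt0.
have C1 : 0 < C + 1 by lra.
have bC1 : 0 < b + C + 1 by lra.
pose h := Num.min (Num.min (d / 2) (r1 / 2))
  (Num.min 1 (Num.min (b / (2 * (C + 1))) (t / (b + C + 1)))).
have h0 : 0 < h.
  by rewrite !lt_min !divr_gt0 ?mulr_gt0//= ltr01.
have hd : h <= d / 2 by rewrite /h !ge_min lexx ?orbT.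
have hr : h <= r1 / 2 by rewrite /h !ge_min lexx ?orbT.
have h1 : h <= 1 by rewrite /h !ge_min lexx ?orbT.
have hb : h <= b / (2 * (C + 1)) by rewrite /h !ge_min lexx ?orbT.
have ht : h <= t / (b + C + 1) by rewrite /h !ge_min lexx ?orbT.
pose x := p - (h * Num.sg (a i)) *: delta_mx ord0 i.
have xpj j : x ord0 j - p ord0 j = - (h * Num.sg (a i)) * (j == i)%:R.
  by rewrite !mxE addrAC subrr add0r eqxx/= mulNr.
have xp j : (x - p) ord0 j = - (h * Num.sg (a i)) * (j == i)%:R.
  by rewrite -xpj mxE [(- p) _ _]mxE.
have ex : enorm (x - p) = h.
  rewrite /enorm (bigD1 i)//= big1 => [|j ji]; last first.
    by rewrite xp (negbTE ji) mulr0 expr0n.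
  rewrite xp eqxx mulr1 sqrrN exprMn sqr_sg ai mulr1 addr0 sqrtr_sqr.
  by rewrite ger0_norm// ltW.
have sx : \sum_j a j * (x ord0 j - p ord0 j) = - (h * b).
  rewrite (bigD1 i)//= big1 => [|j ji]; last first.
    by rewrite xpj (negbTE ji) !mulr0.
  by rewrite xpj eqxx mulr1 addr0 mulrN mulrCA (mulrC (a i)) -normrEsg.
have xr : enorm (x - p) < r1 by rewrite ex; lra.
exists x; split => //; first by rewrite ex; lra.
have := ta _ xr; rewrite sx phip ex subr0 opprK ler_norml => /andP[g1 g2].
move: hb ht; rewrite !ler_pdivlMr// => [hb ht|]; last by rewrite mulr_gt0.
by apply/andP; split; nra.
Qed.

(** By contradiction: a violation at radius r leaves a gap 4e. In the pointwise comparison the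
    factor l close to 1 costs at most e and the shell e, so integrating over A yields a gain of at
    least e |A| for every truncation, which minimality forbids. *)
Lemma truncated_curvature_le (s : R) (Omega E : set 'rV[R]_n) p phi
    (a : 'rV[R]_n -> 'I_n -> R) (i : 'I_n) (r1 c C : R) :
  0 < s -> s < 1 / 2 -> open Omega ->
  (sper s E Omega < +oo)%E -> minimizes_sper s E Omega ->
  0 < r1 -> 0 < c -> 0 <= C ->
  (forall y, enorm (y - p) < r1 -> Omega y) ->
  (forall y, enorm (y - p) < r1 -> {for y, continuous phi}) -> phi p = 0 ->
  (forall y, enorm (y - p) < r1 -> (phi y < 0 -> E y) /\ (0 < phi y -> ~ E y)) ->
  (forall x y, enorm (x - p) < r1 -> enorm (y - p) < r1 ->
    `|phi y - phi x - \sum_j a x j * (y ord0 j - x ord0 j)| <=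
      C * enorm (y - x) ^+ 2) ->
  (forall x, enorm (x - p) < r1 -> c <= `|a x i|) ->
  exists M : R, forall r, 0 < r < r1 ->
    (\int[leb]_(y in ~` [set y | (enorm (y - p) < r)%R] `&` ~` E) (kern s (y - p))%:E <=
     \int[leb]_(y in ~` [set y | (enorm (y - p) < r)%R] `&` E) (kern s (y - p))%:E +
     (M * r `^ (1 - 2 * s))%:E)%E.
Proof.
move=> s0 s1 oO fin [mE hmin] r10 c0 C0 GO cphi phip Ephi ta ca.
have [B mB [N0 [N [mN leN N0N]] EB]] := mE.
have BE : B `<=` E by rewrite -EB => y; left.
have EN : E `\` N = B `\` N.
  apply/seteqP; split => y [h Ny]; split => //; last exact: BE.
  by move: h; rewrite -EB => -[//|/N0N].
have mO : measurable Omega by exact: open_measurable_rV.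
(* Passing from phi to psi adds 1 to the Taylor constant and changes the i-th slope by at most 2d <=
   c/2, hence C + 1 and c/2. The factor 2^(1-2s) comes from the radius 2r of the bad set. M does not
   depend on r. *)
pose M := near_constant n s (c / 2) (C + 1) * 2 `^ (1 - 2 * s).
exists M => r /andP[r0 rr1].
set G := [set y | (enorm (y - p) < r)%R].
have mG : measurable G by apply: open_measurable_rV; exact: open_eball.
have mGc : measurable (~` G) by exact: measurableC.
have Gr1 y : G y -> enorm (y - p) < r1 by move=> /= h; exact: lt_trans rr1.
have mK : measurable_fun setT (fun y : 'rV[R]_n => (kern s (y - p))%:E).
  apply/measurable_EFinP.
  exact: (measurableT_comp (@measurable_kern R n s) (measurable_subr p)).
have K0 y : (0 <= (kern s (y - p))%:E)%E by rewrite lee_fin kern_ge0.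
have mGB : measurable (~` G `&` B) by exact: measurableI.
have mGBc : measurable (~` G `&` ~` B) by apply: measurableI => //; exact: measurableC.
rewrite (ge0_integral_eq_off_null mGBc mN leN mK K0); last first.
  exact/setI_eq_off/setC_eq_off.
rewrite (ge0_integral_eq_off_null (W := ~` G `&` E) mGB mN leN mK K0); last first.
  exact: setI_eq_off EN.
have ffin S : measurable S ->
    (\int[leb]_(y in ~` G `&` S) (kern s (y - p))%:E)%E \is a fin_num.
  move=> mS; rewrite ge0_fin_numE; last by apply: integral_ge0.
  apply: le_lt_trans (far_integral_lty s0 p r0).
  apply: ge0_subset_integral => //; first exact: measurableI.
  exact: (measurable_funTS mK).
have := ffin _ mB; have := ffin _ (measurableC mB).
set IP := (\int[leb]_(y in ~` G `&` ~` B) _)%E.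
set IN := (\int[leb]_(y in ~` G `&` B) _)%E.
move=> IPfin INfin; rewrite leNgt; apply/negP.
pose PP := fine IP; pose NN := fine IN.
have PPE : IP = PP%:E by rewrite fineK.
have NNE : IN = NN%:E by rewrite fineK.
have PP0 : 0 <= PP by apply: fine_ge0; apply: integral_ge0.
have NN0 : 0 <= NN by apply: fine_ge0; apply: integral_ge0.
rewrite PPE NNE -EFinD lte_fin => gap.
pose Q := M * r `^ (1 - 2 * s).
have QE : near_constant n s (c / 2) (C + 1) * (2 * r) `^ (1 - 2 * s) = Q.
  by rewrite powRM ?(ltW r0)// mulrA.
pose e := (PP - NN - Q) / 4.
have e0 : 0 < e by rewrite /e; move: gap; rewrite -/Q => ?; lra.
pose eta := e / (PP + NN + 1).
have S0 : 0 < PP + NN + 1 by lra.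
have eta0 : 0 < eta by rewrite divr_gt0.
pose l := 1 + eta.
have l1 : 1 < l by rewrite /l; lra.
have etaS : eta * (PP + NN) <= e.
  have : eta * (PP + NN + 1) = e by rewrite /eta divfK// gt_eqF.
  by move=> h; nra.
have Pl : PP - eta * PP <= PP / l.
  by rewrite ler_pdivlMr ?(lt_trans ltr01)// /l; nra.
pose q := n%:R + 2 * s.
have q0 : 0 < q by exact: exponent_gt0.
pose sh := e * (r / 2) `^ q.
have r2q : 0 < (r / 2) `^ q by rewrite powR_gt0// divr_gt0.
have sh0 : 0 < sh by rewrite mulr_gt0.
have [d1 d10 hd1] := exists_small_shell p r0 sh0.
have [d2 d20 hd2] := exists_ratio r0 q0 l1.
(* The four bounds serve, in order, the geometry of the pointwise estimate, the slope of psi, the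
   measure of the shell, and the factor l. *)
pose d := Num.min (Num.min (r / 6) (c / 4)) (Num.min d1 d2).
have d0 : 0 < d by rewrite !lt_min !divr_gt0//= d10 d20.
have dr : d <= r / 6 by rewrite /d !ge_min lexx ?orbT.
have dc : d <= c / 4 by rewrite /d !ge_min lexx ?orbT.
have dd1 : d <= d1 by rewrite /d !ge_min lexx ?orbT.
have dd2 : d <= d2 by rewrite /d !ge_min lexx ?orbT.
pose t := d ^+ 2; have t0 : 0 < t by rewrite exprn_gt0.
pose psi y := phi y - enorm (y - p) ^+ 2.
have oG : open G by exact: open_eball.
have mphi : measurable_fun G phi.
  by apply: measurable_fun_of_continuous_in => // y /Gr1; exact: cphi.
have mpsi : measurable_fun G psi.
  apply: measurable_funB => //; apply: measurable_funTS; apply: measurable_funX.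
  exact: (measurableT_comp (@measurable_enorm R n) (measurable_subr p)).
(* As phi <= 0 on B, the set A is contained in the ball of radius d. *)
pose A := B `&` (G `&` psi @^-1` `]- t, +oo[%classic).
have mA : measurable A.
  by apply: measurableI => //; apply: mpsi => //; exact: measurable_itv.
have AB : A `<=` B by move=> y [].
have AG : A `<=` G by move=> y [_ []].
have Apsi y : A y -> - t < psi y.
  by move=> [_ [_]]; rewrite /= in_itv/= andbT.
have Ad y : A y -> enorm (y - p) < d.
  move=> Ay; have := Apsi _ Ay; rewrite /psi => h.
  have : phi y <= 0.
    rewrite leNgt; apply/negP => h'.
    exact: (Ephi _ (Gr1 _ (AG _ Ay))).2 h' (BE _ (AB _ Ay)).
  move=> h'; rewrite -(@ltr_pXn2r _ 2)// ?nnegrE ?enorm_ge0 ?(ltW d0)//.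
  by rewrite -/t; move: h h'; clear; lra.
have Afin : (leb A < +oo)%E.
  by apply: (@enorm_ball_bounded _ _ p d) => //; [exact: ltW|move=> y /Ad/ltW].
have Apos : (0 < leb A)%E.
  (* On this open set phi < 0 gives membership in E, while phi > -t/2 and |y - p|^2 < t/4 give psi >
     -t; so it lies in A up to the null set N. *)
  pose O1 := [set y : 'rV[R]_n | enorm (y - p) < Num.min r (d / 2)] `&`
    phi @^-1` `]- (t / 2), 0[%classic.
  have oO1 : open O1.
    apply: open_preimage_in; [exact: open_eball| |exact: interval_open].
    by move=> y /=; rewrite lt_min => /andP[h _]; apply: cphi; exact: lt_trans rr1.
  have d20' : 0 < d / 2 by rewrite divr_gt0.
  have t20 : 0 < t / 2 by rewrite divr_gt0.
  have pp : enorm (p - p) < r1.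
    by rewrite subrr (eqP (_ : enorm 0 == 0)) ?enorm_eq0.
  have ap0 : a p i != 0 by rewrite -normr_gt0 (lt_le_trans c0)// ca.
  have rd0 : 0 < Num.min r (d / 2) by rewrite lt_min r0.
  have [x0 [x0d x0r /andP[x01 x02]]] := exists_near_negative r10 C0 ap0 phip
    (ta p ^~ pp) t20 rd0.
  have : (0 < leb O1)%E.
    by apply: (leb_open_gt0 (x := x0)) => //; split => //=; rewrite in_itv/= x01.
  move=> /lt_le_trans; apply.
  apply: (@le_trans _ _ (leb (A `|` N))); last first.
    apply: (le_trans (measureU2 _ _ _)) => //.
    by move: leN => /= ->; rewrite adde0.
  apply: le_measure; rewrite ?inE; [exact: open_measurable_rV|exact: measurableU|].
  move=> y [/=]; rewrite lt_min => /andP[yr yd]; rewrite in_itv/= => /andP[y1 y2].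
  have [Ny|Ny] := pselect (N y); first by right.
  left; split.
    by apply/(setD_eq_mem EN Ny); exact: (Ephi _ (Gr1 _ yr)).1.
  split => //=; rewrite in_itv/= andbT /psi.
  have : enorm (y - p) ^+ 2 < (d / 2) ^+ 2.
    by rewrite ltr_pXn2r ?nnegrE ?enorm_ge0 ?(ltW d20').
  by rewrite exprMn -/t; move: y1 t0; clear; lra.
(* psi is known to be measurable only on G; the extension by a constant makes V measurable. *)
pose psiG := psi \_ G.
have mpsiG : measurable_fun setT psiG by apply: (measurable_restrictT _ mG).1.
have psiGE y : A y -> psiG y = psi y by move=> /AG Gy; rewrite /psiG patchE mem_set.
pose V := (A `*` A) `&`
  (fun z : 'rV[R]_n * 'rV[R]_n => psiG z.2 - psiG z.1) @^-1` `]0, +oo[%classic.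
have mV : measurable V.
  apply: measurableI; first exact: measurableX.
  rewrite -[X in measurable X]setTI.
  have m12 : measurable_fun setT (fun z : 'rV[R]_n * 'rV[R]_n => psiG z.2 - psiG z.1).
    apply: measurable_funB.
      exact: (measurableT_comp mpsiG measurable_snd).
    exact: (measurableT_comp mpsiG measurable_fst).
  by apply: m12 => //; exact: measurable_itv.
have VE x y : V (x, y) <-> [/\ A x, A y & psi x < psi y].
  split => [[[/= Ax Ay]]|[Ax Ay xy]].
    by rewrite in_itv/= andbT subr_gt0 !psiGE.
  by split => //=; rewrite in_itv/= andbT subr_gt0 !psiGE.
have VA : V `<=` A `*` A by move=> z [].
have mV1 x : measurable [set y | V (x, y)].
  have mi : measurable_fun setT (fun y : 'rV[R]_n => (x, y)).
    exact: pair1_measurable.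
  by have := mi measurableT V mV; rewrite setTI.
have mV2 x : measurable [set y | V (y, x)].
  have mi : measurable_fun setT (fun y : 'rV[R]_n => (y, x)).
    exact: pair2_measurable.
  by have := mi measurableT V mV; rewrite setTI.
have BAfin : (sper s B Omega < +oo)%E.
  by rewrite -(sper_eq_off_null s mB mO mN leN EN).
have Bmin : (sper s B Omega <= sper s (B `\` A) Omega)%E.
  (* The competitor is [E \ A] rather than [B \ A]: it must coincide with E outside Omega exactly,
     not just up to a null set. Both perimeters are then transferred to B. *)
  have EA : (E `\` A) `\` N = (B `\` A) `\` N.
    by rewrite !(setDE _ A) !(setIC _ (~` A)); exact: setI_eq_off.
  rewrite -(sper_eq_off_null s mB mO mN leN EN).
  rewrite -(sper_eq_off_null s (measurableD mB mA) mO mN leN EA).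
  apply: hmin.
    exists (B `\` A); first exact: measurableD.
    exists (N0 `\` A); last by rewrite -setDUl EB.
    by exists N; split => // y [/N0N].
  apply/seteqP; split => y [h1 h2]; split => //; first exact: h1.1.
  by split => // /AG/Gr1/GO.
have AO : A `<=` B `&` Omega by move=> y Ay; split; [exact: AB|exact/GO/Gr1/AG].
have [Ifin Imin] := minimality_removal mA mB mO AO BAfin Bmin.
(* The truncation radii start at r/2, as the pointwise estimate requires [2 * rho <= r]; the gain is
   the same for every m. *)
have gain m : (double_integral (pair_kern_trunc s (r / 2 / m.+1%:R)) (A `*` (B `\` A))
    + e%:E * leb A <= interaction s A (~` B))%E.
  set rho := r / 2 / m.+1%:R.
  have rho0 : 0 < rho by rewrite !divr_gt0.
  have rhor : 2 * rho <= r.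
    by rewrite /rho mulrA mulrCA divff// mulr1 ler_pdivrMr// ler_pMr// ler1n.
  apply: (@le_trans _ _
    (double_integral (pair_kern_trunc s rho) (A `*` ~` B))); last first.
    rewrite interactionE; apply: ge0_le_integral => //.
    - by apply: measurableX => //; exact: measurableC.
    - by move=> z _; rewrite lee_fin kern_trunc_ge0.
    - apply: measurable_funTS; apply/measurable_EFinP.
      exact: measurable_pair_kern_trunc.
    - by apply: measurable_funTS; apply/measurable_EFinP; exact: measurable_pair_kern.
    - by move=> z _; rewrite lee_fin kern_trunc_le.
  apply: (@double_integral_strict_gain _ _ _ _ _ _ A B V (rho `^ q)^-1) => //.
  - exact: measurable_pair_kern_trunc.
  - by move=> z; exact: kern_trunc_ge0.
  - exact: pair_kern_trunc_sym.
  - by move=> z; exact: kern_trunc_bounded.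
  - by rewrite invr_ge0 powR_ge0.
  - exact: ltW.
  move=> x Ax.
  have Gx := AG _ Ax; have xr1 := Gr1 _ Gx; have xd := Ad _ Ax.
  pose a' j := a x j - 2 * (x ord0 j - p ord0 j).
  have taylor y : G y ->
      `|psi y - psi x - \sum_j a' j * (y ord0 j - x ord0 j)| <=
        (C + 1) * enorm (y - x) ^+ 2.
    move=> Gy; have := ta x y xr1 (Gr1 _ Gy).
    set T := \sum_j a x j * _.
    (* The square |y - p|^2 equals its first-order expansion at x plus exactly |y - x|^2. *)
    have -> : \sum_j a' j * (y ord0 j - x ord0 j) =
        T - (enorm (y - p) ^+ 2 - enorm (x - p) ^+ 2 - enorm (y - x) ^+ 2).
      rewrite !enorm_sqr /T -!sumrB; apply: eq_bigr => j _.
      by rewrite /a' !mxE; ring.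
    rewrite /psi => h.
    rewrite (_ : _ - _ = (phi y - phi x - T) - enorm (y - x) ^+ 2); last by ring.
    apply: (le_trans (ler_normB _ _)).
    by rewrite mulrDl mul1r lerD// ger0_norm// exprn_ge0// enorm_ge0.
  have ca' : c / 2 <= `|a' i|.
    have h1 := ca _ xr1.
    have h2 : `|x ord0 i - p ord0 i| <= d.
      have := ler_coord_enorm (x - p) i; rewrite !mxE => h.
      by rewrite (le_trans h)// ltW.
    have h3 : `|a x i| <= `|a' i| + `|2 * (x ord0 i - p ord0 i)|.
      by rewrite (le_trans _ (ler_normD _ _))// subrK.
    move: h3; rewrite normrM (ger0_norm (_ : 0 <= 2))// => h3.
    by move: h1 h2 h3 dc; clear; lra.
  have kE y : pair_kern_trunc s rho (x, y) = kern_trunc s rho (y - x).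
    by rewrite pair_kern_trunc_sym.
  under eq_integral do rewrite kE; under [leRHS]eq_integral do rewrite kE.
  have hPP : (PP%:E <= \int[leb]_(y in ~` G `&` ~` B) (kern s (y - p))%:E)%E.
    by rewrite -PPE.
  have hNN : (\int[leb]_(y in ~` G `&` B) (kern s (y - p))%:E <= NN%:E)%E.
    by rewrite -NNE.
  have hsh : (leb [set y : 'rV[R]_n | (r - 2 * d <= enorm (y - p) < r)%R] <= sh%:E)%E.
    by apply: hd1; rewrite d0.
  have hl : (r / (r - d)) `^ (n%:R + 2 * s) <= l by apply: hd2; rewrite d0.
  have hdr : 6 * d <= r by move: dr; clear; lra.
  have mP : measurable [set y | ~ B y \/ V (x, y)].
    exact: (measurableU _ _ (measurableC mB) (mV1 x)).
  have mN' : measurable [set y | (B y /\ ~ A y) \/ V (y, x)].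
    exact: (measurableU _ _ (measurableD mB mA) (mV2 x)).
  have inA y : G y -> B y -> - t < psi y -> A y.
    by move=> Gy By h; split => //; split => //=; rewrite in_itv/= h.
  have NG y : G y -> (B y /\ ~ A y) \/ V (y, x) -> psi y < psi x.
    move=> Gy [[By nAy]|/VE[//]].
    apply: le_lt_trans (Apsi _ Ax); rewrite leNgt; apply/negP => h.
    exact/nAy/inA.
  have PG y : G y -> psi x < psi y -> ~ B y \/ V (x, y).
    move=> Gy xy; have [By|By] := pselect (B y); [right|by left].
    apply/VE; split => //; apply: inA => //.
    exact: lt_trans (Apsi _ Ax) xy.
  have Pfar y : ~ G y -> ~ B y -> ~ B y \/ V (x, y) by left.
  have Nfar y : ~ G y -> (B y /\ ~ A y) \/ V (y, x) -> B y.
    by move=> _ [[]//|/VE[/AB]].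
  have c20 : 0 < c / 2 by rewrite divr_gt0.
  have C10 : 0 <= C + 1 by rewrite addr_ge0.
  have := @pointwise_le R n s s0 s1 p x r d rho B
    [set y | ~ B y \/ V (x, y)] [set y | (B y /\ ~ A y) \/ V (y, x)]
    psi a' i (c / 2) (C + 1) r0 d0 hdr (ltW xd) rho0 rhor mB mP mN'
    NG PG Pfar Nfar c20 C10 ca' taylor sh l PP NN hsh hl hPP hNN.
  rewrite QE; apply: adde_cancel.
  rewrite /sh mulrCA mulVf ?gt_eqF// mulr1.
  have : PP - NN - Q = 4 * e by rewrite /e mulrC divfK.
  rewrite /l mulrDl mul1r; move: etaS Pl e0; rewrite mulrDr; clear; lra.
(* In the limit, I(A, ~B) <= I(A, [B \ A]) <= I(A, ~B) - e |A|, which is absurd since I(A, ~B) is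
   finite and e |A| > 0. *)
have wfin : (e%:E * leb A)%E \is a fin_num.
  rewrite ge0_fin_numE; last by rewrite mule_ge0// lee_fin ltW.
  by apply: lte_mul_pinfty => //; rewrite lee_fin ltW.
have r20 : 0 < r / 2 by rewrite divr_gt0.
have := @interaction_le_of_trunc R n s s0 A (B `\` A) (r / 2)
  (interaction s A (~` B) - e%:E * leb A)%E mA (measurableD mB mA) r20.
move=> /(_ (fun m => _)) H.
have {}H : (interaction s A (~` B) <= interaction s A (~` B) - e%:E * leb A)%E.
  by apply: (le_trans Imin); apply: H => m; rewrite leeBrDr.
have ufin : interaction s A (~` B) \is a fin_num.
  by rewrite ge0_fin_numE// integral_ge0// => z _; rewrite lee_fin invr_ge0 powR_ge0.
have w0 : (0 < e%:E * leb A)%E by rewrite mule_gt0// lte_fin.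
by move: H; rewrite leNgt => /negP; apply; rewrite lteBlDr// lteDl.
Qed.

End one_sided.

(** * Smooth defining functions *)

Section taylor.
Context (R : realType) (n : nat).
Implicit Types (p x y : 'rV[R]_n) (f phi : 'rV[R]_n -> R).

Lemma derivable_line f x (v : 'rV[R]_n) (t : R) : derivable f (x + t *: v) v ->
  is_derive t (1 : R) (fun u : R => f (x + u *: v)) ('D_v f (x + t *: v)).
Proof.
move=> df.
have E : (fun h : R => h^-1 *: (((fun u : R => f (x + u *: v)) \o shift t) (h *: (1 : R))
      - f (x + t *: v))) =
    (fun h : R => h^-1 *: ((f \o shift (x + t *: v)) (h *: v) - f (x + t *: v))).
  apply/funext => h /=; congr (_ *: (f _ - _)).
  by rewrite /shift/= scalerDl addrCA [h *: 1]mulr1.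
apply: DeriveDef; first by rewrite /derivable E.
by rewrite /derive E.
Qed.

Lemma mvt_direction f x (v : 'rV[R]_n) (h : R) :
  (forall u, 0 <= u <= 1 -> derivable f (x + (u * h) *: v) v) ->
  exists2 u, 0 <= u <= 1 & f (x + h *: v) - f x = 'D_v f (x + (u * h) *: v) * h.
Proof.
move=> df; pose g (t : R) := f (x + t *: v).
have gx : g 0 = f x by rewrite /g scale0r addr0.
have [->|h0] := eqVneq h 0.
  by exists 0; rewrite ?lexx ?ler01// scale0r addr0 subrr mulr0.
have dg t : 0 <= t / h <= 1 -> is_derive t (1 : R) g ('D_v f (x + t *: v)).
  move=> th; apply: derivable_line; rewrite -(divfK h0 t); exact: df.
have [hp|hn|/eqP] := ltgtP 0 h; last by rewrite eq_sym (negbTE h0).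
  have in01 t : t \in `[0, h] -> 0 <= t / h <= 1.
    by rewrite in_itv/= => /andP[t0 th]; rewrite divr_ge0 ?(ltW hp)//= ler_pdivrMr// mul1r.
  have [| |c ch e] := @MVT_segment R g (fun t => 'D_v f (x + t *: v)) 0 h (ltW hp).
  - by move=> t /subset_itv_oo_cc/in01/dg.
  - by apply: derivable_within_continuous => t /in01/dg[].
  exists (c / h); first exact: in01.
  by rewrite divfK// -/(g h) -gx e subr0.
have in01 t : t \in `[h, 0] -> 0 <= t / h <= 1.
  rewrite in_itv/= => /andP[t0 th]; rewrite -mulrNN -invrN.
  by rewrite divr_ge0 ?oppr_ge0 ?(ltW hn)//= ler_pdivrMr ?oppr_gt0// mul1r lerN2.
have [| |c ch e] := @MVT_segment R g (fun t => 'D_v f (x + t *: v)) h 0 (ltW hn).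
- by move=> t /subset_itv_oo_cc/in01/dg.
- by apply: derivable_within_continuous => t /in01/dg[].
exists (c / h); first exact: in01.
by rewrite divfK// -/(g h) -gx -opprB e sub0r mulrN opprK.
Qed.

(* Changing the coordinates one at a time, only partial derivatives are used. *)
Lemma mvt_coordinates f p (r : R) x y :
  (forall z, `|z - p| < r -> forall i, derivable f z (delta_mx ord0 i)) ->
  `|x - p| < r -> `|y - p| < r ->
  exists xi : 'I_n -> 'rV[R]_n,
    (forall i, `|xi i - p| < r /\ `|xi i - x| <= `|y - x|) /\
    f y - f x = \sum_i 'D_(delta_mx ord0 i) f (xi i) * (y ord0 i - x ord0 i).
Proof.
move=> df xr yr; have r0 : 0 < r := le_lt_trans (normr_ge0 _) xr.
pose w (k : nat) : 'rV[R]_n := \row_j (if (j < k)%N then y ord0 j else x ord0 j).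
have w0 : w 0%N = x by apply/rowP => j; rewrite !mxE.
have wn : w n = y by apply/rowP => j; rewrite !mxE ltn_ord.
have wS (i : 'I_n) : w i.+1 = w i + (y ord0 i - x ord0 i) *: delta_mx ord0 i.
  apply/rowP => j; rewrite !mxE eqxx/= ltnS leq_eqVlt.
  have [ji|ji] := eqVneq j i; first by rewrite ji eqxx ltnn/= mulr1 addrC subrK.
  by rewrite (_ : (j == i :> nat) = false) ?mulr0 ?addr0//; apply/negbTE.
have wc (i : 'I_n) u j : 0 <= u <= 1 -> exists2 v, 0 <= v <= 1 &
    (w i + (u * (y ord0 i - x ord0 i)) *: delta_mx ord0 i) ord0 j =
      x ord0 j + v * (y ord0 j - x ord0 j).
  move=> u01; rewrite !mxE eqxx/=.
  have [->|ji] := eqVneq j i; first by exists u => //; rewrite ltnn mulr1.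
  rewrite mulr0 addr0; case: ifP => _; last by exists 0; rewrite ?lexx ?ler01// mul0r addr0.
  by exists 1; rewrite ?lexx ?ler01// mul1r addrC subrK.
have win (i : 'I_n) u : 0 <= u <= 1 ->
    let z := w i + (u * (y ord0 i - x ord0 i)) *: delta_mx ord0 i in
    `|z - p| < r /\ `|z - x| <= `|y - x|.
  move=> u01 z; split.
    rewrite (norm_lt_coord _ r0); apply/forallP => j; rewrite mxE [(- p) _ _]mxE.
    have [v /andP[v0 v1] ->] := wc i u j u01.
    have := ler_coord_norm (x - p) j; have := ler_coord_norm (y - p) j.
    rewrite mxE [(- p) _ _]mxE [(x - p) _ _]mxE [(- p) _ _]mxE => hy hx.
    have {hx}/ltr_normlP[hx1 hx2] := le_lt_trans hx xr.
    have {hy}/ltr_normlP[hy1 hy2] := le_lt_trans hy yr.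
    rewrite ltr_norml; have [xy|xy] := leP (x ord0 j) (y ord0 j).
      have : 0 <= v * (y ord0 j - x ord0 j) <= y ord0 j - x ord0 j.
        by rewrite mulr_ge0 ?ler_piMl ?subr_ge0.
      by move=> /andP[? ?]; apply/andP; split; lra.
    have : y ord0 j - x ord0 j <= v * (y ord0 j - x ord0 j) <= 0.
      by rewrite mulr_ge0_le0 ?ler_niMl ?subr_le0 ?(ltW xy).
    by move=> /andP[? ?]; apply/andP; split; lra.
  rewrite norm_le_coord//; apply/forallP => j; rewrite mxE [(- x) _ _]mxE.
  have [v /andP[v0 v1] ->] := wc i u j u01.
  rewrite addrAC subrr add0r normrM (ger0_norm v0).
  have := ler_coord_norm (y - x) j; rewrite mxE [(- x) _ _]mxE => h.
  by rewrite (le_trans _ h)// ler_piMl.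
have step (i : 'I_n) : exists u, 0 <= u <= 1 /\ f (w i.+1) - f (w i) =
    'D_(delta_mx ord0 i) f (w i + (u * (y ord0 i - x ord0 i)) *: delta_mx ord0 i)
    * (y ord0 i - x ord0 i).
  rewrite wS.
  have [|u u01 e] :=
    @mvt_direction f (w i) (delta_mx ord0 i) (y ord0 i - x ord0 i).
    by move=> u u01; apply: df; exact: (win i u u01).1.
  by exists u.
have /fin_all_exists[u hu] := step.
exists (fun i : 'I_n => w i + (u i * (y ord0 i - x ord0 i)) *: delta_mx ord0 i); split.
  by move=> i; exact: (win i (u i) (hu i).1).
have -> : f y - f x = \sum_(i < n) (f (w i.+1) - f (w i)).
  rewrite -(big_mkord xpredT (fun k => f (w k.+1) - f (w k))).
  by rewrite (telescope_sumr (fun k => f (w k))) ?leq0n// wn w0.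
by apply: eq_bigr => i _; exact: (hu i).2.
Qed.

(** The coordinatewise mean value formula is applied to phi, then to each first partial derivative
    between x and the intermediate point. Each application sums over n coordinates, whence the
    constant n (n K). *)
Lemma taylor_bound phi p (r K : R) :
  (forall z, `|z - p| < r -> forall i, derivable phi z (delta_mx ord0 i)) ->
  (forall z, `|z - p| < r -> forall i j,
     derivable ('D_(delta_mx ord0 i) phi) z (delta_mx ord0 j)) ->
  (forall z, `|z - p| < r -> forall i j,
     `|'D_(delta_mx ord0 j) ('D_(delta_mx ord0 i) phi) z| <= K) ->
  forall x y, `|x - p| < r -> `|y - p| < r ->
  `|phi y - phi x - \sum_i 'D_(delta_mx ord0 i) phi x * (y ord0 i - x ord0 i)|
    <= (n%:R * (n%:R * K)) * enorm (y - x) ^+ 2.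
Proof.
move=> d1 d2 bd x y xr yr.
have pr : `|p - p| < r by rewrite subrr normr0 (le_lt_trans _ xr).
have K0 (i : 'I_n) : 0 <= K := le_trans (normr_ge0 _) (bd p pr i i).
have [xi [hxi ->]] := mvt_coordinates d1 xr yr.
rewrite -sumrB.
apply: (le_trans (ler_norm_sum _ _ _)).
have yx : `|y - x| <= enorm (y - x) := norm_le_enorm _.
apply: (@le_trans _ _ (\sum_(i < n) n%:R * K * enorm (y - x) ^+ 2)); last first.
  by rewrite sumr_const card_ord -[leLHS]mulr_natl !mulrA.
apply: ler_sum => i _; rewrite -mulrBl normrM.
have [xir xix] := hxi i.
have [et [het ->]] := mvt_coordinates (fun z hz j => d2 z hz i j) xr xir.
rewrite expr2 mulrA; apply: ler_pM => //; last first.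
  by apply: (le_trans _ yx); have := ler_coord_norm (y - x) i; rewrite mxE [(- x) _ _]mxE.
apply: (le_trans (ler_norm_sum _ _ _)).
apply: (@le_trans _ _ (\sum_(j < n) K * enorm (y - x))); last first.
  by rewrite sumr_const card_ord -[leLHS]mulr_natl !mulrA.
apply: ler_sum => j _; rewrite normrM; apply: ler_pM => //.
  by apply: bd; exact: (het j).1.
apply: (le_trans _ yx); apply: (le_trans _ xix).
by have := ler_coord_norm (xi i - x) j; rewrite mxE [(- x) _ _]mxE.
Qed.

End taylor.

Section smooth_functions.
Context (R : realType) (n : nat).
Implicit Types (p x y : 'rV[R]_n) (phi : 'rV[R]_n -> R).

Lemma smooth_local_taylor (U : set 'rV[R]_n) phi p (i : 'I_n) :
  open U -> U p -> smooth_on U phi -> 'D_(delta_mx ord0 i) phi p != 0 ->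
  exists r C : R, [/\ 0 < r, 0 <= C,
    forall x, enorm (x - p) < r -> U x,
    forall x y, enorm (x - p) < r -> enorm (y - p) < r ->
      `|phi y - phi x - \sum_j 'D_(delta_mx ord0 j) phi x * (y ord0 j - x ord0 j)|
        <= C * enorm (y - x) ^+ 2 &
    forall x, enorm (x - p) < r ->
      `|'D_(delta_mx ord0 i) phi p| / 2 <= `|'D_(delta_mx ord0 i) phi x|].
Proof.
move=> oU Up sm ip.
pose D2 (jk : 'I_n * 'I_n) x :=
  'D_(delta_mx ord0 jk.2) ('D_(delta_mx ord0 jk.1) phi) x.
(* The summand 1 makes every second partial derivative at p strictly smaller than K, so that the
   bound persists near p by continuity. *)
pose K := \sum_jk (`|D2 jk p| + 1).
have K0 : 0 <= K by apply: sumr_ge0 => jk _; rewrite addr_ge0.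
have DK jk : `|D2 jk p| < K.
  by rewrite /K (bigD1 jk)//= -addrA ltrDl ltr_pwDl// sumr_ge0.
have n2 : \forall x \near p, forall jk, `|D2 jk x| < K.
  apply: (@filter_forall _ _ (fun jk x => is_true (`|D2 jk x| < K)) (nbhs p) _).
  move=> jk0; have [c _] := sm [:: jk0.2; jk0.1] p Up.
  exact: (cvgr_norm_lt _ c _ (DK jk0)).
have n1 : \forall x \near p,
    `|'D_(delta_mx ord0 i) phi p| / 2 < `|'D_(delta_mx ord0 i) phi x|.
  have [c _] := sm [:: i] p Up.
  apply: (cvgr_norm_gt _ c).
  by rewrite ltr_pdivrMr// ltr_pMr ?ltr1n// normr_gt0.
have n0 : \forall x \near p, U x by exact: open_nbhs_nbhs.
have /nbhs_ballP[r/= r0 H] : \forall x \near p, U x /\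
   (`|'D_(delta_mx ord0 i) phi p| / 2 < `|'D_(delta_mx ord0 i) phi x| /\
    forall jk, `|D2 jk x| < K).
  by apply: filterI => //; exact: filterI.
have {}H z : `|z - p| < r -> U z /\
   (`|'D_(delta_mx ord0 i) phi p| / 2 < `|'D_(delta_mx ord0 i) phi z| /\
    forall jk, `|D2 jk z| < K).
  by move=> zr; apply: H; rewrite -ball_normE/= distrC.
have ler x : enorm (x - p) < r -> `|x - p| < r.
  exact/le_lt_trans/norm_le_enorm.
exists r, (n%:R * (n%:R * K)); split => //.
- by rewrite !mulr_ge0.
- by move=> x /ler/H[].
- move=> x y /ler xr /ler yr; apply: (@taylor_bound R n phi p r K) => //.
  + by move=> z /H[Uz _] j; exact: (sm [::] z Uz).2.
  + by move=> z /H[Uz _] j k; exact: (sm [:: j] z Uz).2.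
  + by move=> z /H[_ [_ h]] j k; exact/ltW/(h (j, k)).
- by move=> x /ler/H[_ [/ltW h _]].
Qed.

(** If phi p < 0, then E contains a neighbourhood of p; if phi p > 0, some neighbourhood of p misses
    E. Neither can happen at a boundary point. *)
Lemma defining_function_frontier (E U : set 'rV[R]_n) phi p : open U -> U p ->
  {for p, continuous phi} ->
  (forall x, U x -> (phi x < 0 -> E x) /\ (0 < phi x -> ~ E x)) ->
  frontier E p -> phi p = 0.
Proof.
move=> oU Up cphi Ephi [clE nintE].
have nU : nbhs p U by exact: open_nbhs_nbhs.
have [h|h|//] := ltgtP (phi p) 0; exfalso.
- apply: nintE; rewrite /interior/=.
  have : \forall x \near p, phi x < 0 by apply: (cvgr_lt _ cphi).
  move=> nphi; apply: filterS (filterI nU nphi) => x [Ux px].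
  exact: (Ephi x Ux).1.
have : \forall x \near p, 0 < phi x by apply: (cvgr_gt _ cphi).
move=> nphi; have [x [Ex [Ux px]]] := clE _ (filterI nU nphi).
exact: (Ephi x Ux).2 px Ex.
Qed.

End smooth_functions.

(** * Passing to the complement *)

Section complement.
Context (R : realType) (n : nat) (s : R).
Implicit Types E Omega : set 'rV[R]_n.

Lemma lebesgue_measurable_rep E : lebesgue_measurable E ->
  exists B N : set 'rV[R]_n, [/\ measurable B, measurable N, leb N = 0%E,
    B `<=` E & E `\` N = B `\` N].
Proof.
move=> [B mB [N0 [N [mN leN N0N]] EB]]; exists B, N; split => //.
  by rewrite -EB => y; left.
apply/seteqP; split => y [h Ny]; split => //; last by rewrite -EB; left.
by move: h; rewrite -EB => -[//|/N0N].
Qed.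

Lemma lebesgue_measurableC E : lebesgue_measurable E -> lebesgue_measurable (~` E).
Proof.
move=> /lebesgue_measurable_rep[B [N [mB mN leN BE EN]]].
exists (~` B `\` N); first by apply: measurableD => //; exact: measurableC.
exists (N `\` E); first by exists N; split => // x [].
apply/seteqP; split => x.
  move=> [[nB nN]|[]//] Ex; have : (E `\` N) x by [].
  by rewrite EN => -[].
move=> nE; have [Nx|Nx] := pselect (N x); [by right|left; split => //].
by move=> /BE.
Qed.

(** Complementation transposes the first interaction and exchanges the other two up to
    transposition. The symmetry of [interaction] requires Borel sets, hence the passage to B. *)
Lemma sperC E Omega : measurable Omega -> lebesgue_measurable E ->
  sper s (~` E) Omega = sper s E Omega.
Proof.
move=> mO /lebesgue_measurable_rep[B [N [mB mN leN BE EN]]].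
have mBc : measurable (~` B) by exact: measurableC.
rewrite (sper_eq_off_null s mB mO mN leN EN).
rewrite (sper_eq_off_null s mBc mO mN leN (setC_eq_off EN)) /sper setCK.
rewrite (interactionC s (S1 := ~` B `&` Omega) (S2 := B `&` Omega));
  [|exact: measurableI..].
rewrite (interactionC s (S1 := ~` B `&` Omega) (S2 := B `\` Omega));
  [|exact: measurableI|exact: measurableD].
rewrite (interactionC s (S1 := ~` B `\` Omega) (S2 := B `&` Omega));
  [|exact: measurableD|exact: measurableI].
by rewrite addeAC.
Qed.

Lemma minimizes_sperC E Omega : measurable Omega ->
  minimizes_sper s E Omega -> minimizes_sper s (~` E) Omega.
Proof.
move=> mO [mE hmin]; split; first exact: lebesgue_measurableC.
move=> F mF FE; rewrite sperC// -(sperC mO mF); apply: hmin.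
  exact: lebesgue_measurableC.
apply/seteqP; split => x [h nO]; split => //.
  apply: contrapT => nE; have : (~` E `\` Omega) x by [].
  by rewrite -FE => -[].
by move=> Fx; have : (F `\` Omega) x by []; rewrite FE => -[].
Qed.

End complement.

(** * The principal value as a limit of differences of finite integrals *)

Section mean_curvature.
Context (R : realType) (n : nat) (s : R).
Implicit Types E : set 'rV[R]_n.

(** The integral is by definition that of the positive part minus that of the negative part, and
    these parts live on ~E and on E respectively; no measurability of E is needed. *)
Lemma truncated_mean_curvatureE E (p : 'rV[R]_n) (rho : R) :
  truncated_mean_curvature s E p rho =
  (\int[leb]_(x in ~` [set x | (enorm (x - p) < rho)%R] `&` ~` E) (kern s (x - p))%:E -
   \int[leb]_(x in ~` [set x | (enorm (x - p) < rho)%R] `&` E) (kern s (x - p))%:E)%E.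
Proof.
rewrite /truncated_mean_curvature integralE; congr (_ - _)%E;
  rewrite [RHS]integral_mkcondr; apply: eq_integral => x _;
  rewrite patchE ?funepos.unlock ?funeneg.unlock !indicE in_setC;
  rewrite -/(kern s (x - p)) -[point]/(0%E : \bar R).
  case: (x \in E); rewrite /=.
    by rewrite sub0r mulN1r; apply/max_idPr; rewrite lee_fin oppr_le0 kern_ge0.
  by rewrite subr0 mul1r; apply/max_idPl; rewrite lee_fin kern_ge0.
case: (x \in E); rewrite /=.
  by rewrite sub0r mulN1r opprK; apply/max_idPl; rewrite lee_fin kern_ge0.
by rewrite subr0 mul1r; apply/max_idPr; rewrite lee_fin oppr_le0 kern_ge0.
Qed.

End mean_curvature.

(** Both far integrals are finite, so the two inequalities place the truncated curvature between -M2
    rho^(1-2s) and M1 rho^(1-2s), which tend to 0 because s < 1/2. *)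
Lemma mean_curvature0_of_bounds (R : realType) (n : nat) (s : R) (hs0 : 0 < s)
    (hs1 : s < 1 / 2) (E : set 'rV[R]_n) (p : 'rV[R]_n) (r M1 M2 : R) :
  0 < r ->
  (forall rho, 0 < rho < r ->
    (\int[leb]_(y in ~` [set y | (enorm (y - p) < rho)%R] `&` ~` E) (kern s (y - p))%:E <=
     \int[leb]_(y in ~` [set y | (enorm (y - p) < rho)%R] `&` E) (kern s (y - p))%:E +
     (M1 * rho `^ (1 - 2 * s))%:E)%E) ->
  (forall rho, 0 < rho < r ->
    (\int[leb]_(y in ~` [set y | (enorm (y - p) < rho)%R] `&` E) (kern s (y - p))%:E <=
     \int[leb]_(y in ~` [set y | (enorm (y - p) < rho)%R] `&` ~` E) (kern s (y - p))%:E +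
     (M2 * rho `^ (1 - 2 * s))%:E)%E) ->
  truncated_mean_curvature s E p rho @[rho --> 0^'+] --> 0%E.
Proof.
move=> r0 H1 H2.
have e0 : 0 < 1 - 2 * s by lra.
have lim (M : R) : (M * rho `^ (1 - 2 * s))%:E @[rho --> 0^'+] --> 0%E.
  apply: cvg_EFin; first exact: nearW.
  rewrite -[X in _ --> X](mulr0 M); apply: cvgM; first exact: cvg_cst.
  exact: powR_cvg0.
apply: (squeeze_cvge _ (lim (- M2)) (lim M1)).
exists r => //= rho /=; rewrite sub0r normrN => rhor rho0.
have {}rhor : 0 < rho < r by rewrite rho0 -(gtr0_norm rho0).
have := H1 _ rhor; have := H2 _ rhor; rewrite truncated_mean_curvatureE.
have ffin S : (\int[leb]_(y in ~` [set y | (enorm (y - p) < rho)%R] `&` S)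
    (kern s (y - p))%:E)%E \is a fin_num.
  rewrite ge0_fin_numE; last by apply: integral_ge0 => y _; rewrite lee_fin kern_ge0.
  apply: le_lt_trans (far_integral_lty hs0 p rho0).
  apply: ge0_subset_integral_sup; last by move=> y [].
  by move=> y; rewrite lee_fin kern_ge0.
rewrite -(fineK (ffin E)) -(fineK (ffin (~` E))).
move: (fine _) (fine _) => u v; rewrite -!EFinD !lee_fin mulNr => h1 h2.
by apply/andP; split; lra.
Qed.

Theorem lemma1p1 (R : realType) (n : nat) (s : R) (Omega E : set 'rV[R]_n)
  (hs0 : 0 < s) (hs1 : s < 1 / 2)
  (hOmega : open Omega)
  (hE : smooth_boundary E)
  (hfin : (sper s E Omega < +oo)%E)
  (hmin : minimizes_sper s E Omega) :
  forall p : 'rV[R]_n, frontier E p -> Omega p ->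
    cvg (truncated_mean_curvature s E p rho @[rho --> 0^'+]) /\
    mean_curvature s E p = 0%E.
Proof.
move=> p fp Op.
have [U [phi [oU Up sm grad side]]] := hE p fp.
have [i ip] := grad p Up.
have phip : phi p = 0 := defining_function_frontier oU Up (sm [::] p Up).1 side fp.
(* Restricting to Omega makes the ball on which the Taylor bound holds lie in Omega as well. *)
have smO : smooth_on (U `&` Omega) phi by move=> l x [Ux _]; exact: sm.
have [r [C [r0 C0 rU tay low]]] :=
  smooth_local_taylor (openI oU hOmega) (conj Up Op) smO ip.
have c0 : 0 < `|'D_(delta_mx ord0 i) phi p| / 2 by rewrite divr_gt0 ?normr_gt0.
have rO y : enorm (y - p) < r -> Omega y by move=> /rU[].
have rside y : enorm (y - p) < r -> (phi y < 0 -> E y) /\ (0 < phi y -> ~ E y).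
  by move=> /rU[/side].
have cphi y : enorm (y - p) < r -> {for y, continuous phi}.
  by move=> /rU[Uy _]; exact: (sm [::] y Uy).1.
have [M1 H1] := @truncated_curvature_le R n s Omega E p phi
  (fun x j => 'D_(delta_mx ord0 j) phi x) i r _ C hs0 hs1 hOmega hfin hmin
  r0 c0 C0 rO cphi phip rside tay low.
have mO := open_measurable_rV hOmega.
have [|||||||M2 H2] := @truncated_curvature_le R n s Omega (~` E) p
  (fun x => - phi x) (fun x j => - 'D_(delta_mx ord0 j) phi x) i r
  (`|'D_(delta_mx ord0 i) phi p| / 2) C hs0 hs1 hOmega _ _ r0 c0 C0 rO.
- by rewrite sperC//; exact: hmin.1.
- exact: minimizes_sperC.
- by move=> y /cphi h; exact: continuousN.
- by rewrite phip oppr0.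
- move=> y /rside[h1 h2]; rewrite oppr_lt0 oppr_gt0; split => //.
  by move=> /h1 Ey; apply.
- move=> x y xr yr; have := tay x y xr yr.
  rewrite -normrN => h; apply: le_trans h.
  rewrite le_eqVlt; apply/orP; left; apply/eqP; congr (`|_|).
  under eq_bigr do rewrite mulNr.
  by rewrite !sumrN; ring.
- by move=> x /low; rewrite normrN.
rewrite setCK in H2.
have lim := mean_curvature0_of_bounds hs0 hs1 r0 H1 H2.
split; first by apply/cvg_ex; exists 0%E.
exact: cvg_lim.
Qed.
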